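(* Let $L>0$, $\beta>0$, $p\in(1,\infty)$, $$A_{p,L,\beta}=\Big\{b\in L^1_{\rm loc}(\mathbb{R})\ \Big|\ b(\cdot+L)=b(\cdot),\ b\ge 0,\ \frac1L\int_0^L b^p\,dx=\beta\Big\},$$ and let $b_0:=\beta^{1/p}$ (constant function). If $p\ge 3/2$, or if $1<p<3/2$ and $\beta^{1/p}<\dfrac{2(p-1)\pi^2}{(3-2p)L^2}$, then $b_0$ is a local maximizer of $c^*$ in $A_{p,L,\beta}$; more precisely, there exists $\eta>0$ such that $$c^*(b_0)>c^*(b)\quad\text{for any } b\in A_{p,L,\beta}\text{ with }0<\|b_0-b\|_{L^\infty}\le\eta.$$ If $1<p<3/2$ and $\beta^{1/p}>\dfrac{2(p-1)\pi^2}{(3-2p)L^2}$, then $b_0$ is neither a local maximizer nor a local minimizer of $c^*$ in $A_{p,L,\beta}$.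
   Context: For $\lambda\in\mathbb{R}$ and a real $L$-periodic function $b\in L^1_{\rm loc}(\mathbb{R})$, $k(\lambda,b)\in\mathbb{R}$ denotes the principal eigenvalue of $-L_{\lambda,b}\psi:=-\psi''-2\lambda\psi'-(b(x)+\lambda^2)\psi$ on $\mathbb{R}/L\mathbb{Z}$, i.e. the unique real number for which $-L_{\lambda,b}\psi=k(\lambda,b)\psi$ has an $L$-periodic positive solution $\psi$. For $b\ge0$, $b\not\equiv0$, the minimal speed of pulsating traveling waves of $u_t=u_{xx}+b(x)(1-u)u$ is $c^*(b)=\min_{\lambda>0}\frac{-k(\lambda,b)}{\lambda}$. ''Local'' is meant with respect to $L^\infty$-perturbations, i.e. the distance $\|b-b_0\|_{L^\infty}$. *)

(* Defs.v *)
From HB Require Import structures.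
From mathcomp Require Import all_boot all_order all_algebra.
From mathcomp Require Import all_classical all_reals all_analysis.
Import Order.TTheory GRing.Theory Num.Theory.
Import numFieldNormedType.Exports.

Set Implicit Arguments.
Unset Strict Implicit.
Unset Printing Implicit Defensive.

Local Open Scope classical_set_scope.
Local Open Scope ring_scope.

(* Elements of L^1_loc are represented by functions R -> R; since they only
   matter up to null sets, pointwise conditions on them are required almost
   everywhere. *)

Definition ae_periodic (R : realType) (L : R) (b : R -> R) : Prop :=
  {ae (@lebesgue_measure R), forall x, b (x + L) = b x}.

Definition Linf_dist (R : realType) (f g : R -> R) : \bar R :=
  ('N[@lebesgue_measure R]_ +oo [EFin \o (f \- g)%R])%E.

(* psi is of class W^{2,1}_loc: psi1 is its derivative, and psi2 is an L^1_loc
   function of which psi1 is a primitive. *)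
Definition W21loc (R : realType) (psi psi1 psi2 : R -> R) : Prop :=
  [/\ forall x : R, is_derive x 1 psi (psi1 x),
      locally_integrable setT psi2 &
      forall x y : R, x <= y ->
        psi1 y - psi1 x = \int[@lebesgue_measure R]_(t in `[x, y]) psi2 t].

(* - psi'' - 2 lambda psi' - (b + lambda^2) psi = k psi has an L-periodic
   positive solution psi.  As b is only L^1_loc, psi is sought in W^{2,1}_loc
   and the equation holds almost everywhere. *)
Definition has_periodic_positive_solution (R : realType)
    (L lambda : R) (b : R -> R) (k : R) : Prop :=
  exists psi psi1 psi2 : R -> R,
    [/\ W21loc psi psi1 psi2,
        forall x, psi (x + L) = psi x,
        forall x, 0 < psi x &
        {ae (@lebesgue_measure R), forall x,
          - psi2 x - 2 * lambda * psi1 x - (b x + lambda ^+ 2) * psi x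
          = k * psi x}].

(* The default value 0 is used only if no such real number exists; for
   L-periodic b in L^1_loc there is exactly one. *)
Definition principal_eigenvalue (R : realType) (L lambda : R) (b : R -> R) : R :=
  xget 0 [set k | has_periodic_positive_solution L lambda b k].

Definition speeds (R : realType) (L : R) (b : R -> R) : set R :=
  [set - principal_eigenvalue L lambda b / lambda | lambda in [set l | 0 < l]].

(* The minimum (not merely the infimum) of speeds; the default value 0 is used
   only if the minimum is not attained. *)
Definition cstar (R : realType) (L : R) (b : R -> R) : R :=
  xget 0 (speeds L b `&` lbound (speeds L b)).

Definition admissible (R : realType) (p L beta : R) : set (R -> R) :=
  [set b | [/\ locally_integrable setT b,
               ae_periodic L b,
               {ae (@lebesgue_measure R), forall x, 0 <= b x} &
               ((L^-1)%:E *
                 \int[@lebesgue_measure R]_(x in `[0%R, L]) (b x `^ p)%:E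
               = beta%:E)%E]].

Definition local_maximizer (R : realType) (A : set (R -> R))
    (J : (R -> R) -> R) (b0 : R -> R) : Prop :=
  A b0 /\ exists2 eta : R, 0 < eta &
    forall b, A b -> (Linf_dist b0 b <= eta%:E)%E -> J b <= J b0.

Definition local_minimizer (R : realType) (A : set (R -> R))
    (J : (R -> R) -> R) (b0 : R -> R) : Prop :=
  A b0 /\ exists2 eta : R, 0 < eta &
    forall b, A b -> (Linf_dist b0 b <= eta%:E)%E -> J b0 <= J b.

(* Main.v *)
Require Import Defs.
From HB Require Import structures.
From mathcomp Require Import all_boot all_order all_algebra.
From mathcomp Require Import all_classical all_reals all_analysis.
From mathcomp Require Import measurable_realfun ess_sup_inf ring lra.
Import Order.TTheory GRing.Theory Num.Theory.
Import numFieldNormedType.Exports.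
Local Open Scope classical_set_scope.
Local Open Scope ring_scope.

(* Write m for the constant b_0, h = b - m, and w = psi'/psi. The eigenvalue equation
   becomes the Riccati equation w' + 2 lambda w + w^2 + h = C with w periodic of mean
   zero and C = - k - lambda^2 - m, so that C is the mean of h + w^2. Testing with w'
   gives |w'|_2 <= |h|_2, hence w is small. Testing with w' + 2 lambda w and the
   Wirtinger inequality gives (4 lambda^2 + (2 pi/L)^2) |w|_2^2 <= (1 + o(1)) |h|_2^2,
   while the constraint forces the mean of h to be - (p - 1)/(2 m) mean(h^2) up to
   higher order. At lambda = sqrt m, the optimal value for the constant, this yields
   C < 0 exactly when m is below the threshold.

   Conversely let b = m (1 + eps cos(omega x))^(1/p). For the lowest frequency
   omega = 2 pi/L the bound on w is asymptotically attained, so that above the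
   threshold (lambda - sqrt m)^2 + C > 0 for all lambda > 0; a contraction argument,
   uniform in lambda, provides the solutions, and C is Lipschitz in lambda, so the
   minimal speed is attained and exceeds 2 sqrt m. For a high frequency w is much
   smaller than h, so C < 0 at lambda = sqrt m and the minimal speed decreases. *)

(** * Integrals and primitives of bounded functions on a segment *)

(** The two directions are asymmetric. An upper bound on the speed follows from a single [lambda],
    whereas a lower bound must cover all [lambda > 0] at once and calls for existence of the
    eigenvalue and attainment of the minimum. What makes uniform estimates possible is that on a
    period the damping [2 * lambda * w] is orthogonal to [w'], so that it drops out of the energy
    estimate; for large [lambda] the term [(lambda - sqrt m) ^+ 2] takes over. As [b] is only
    measurable, [w'] exists only almost everywhere. The calculus is therefore carried out with
    integrals of bounded functions, for which a product rule follows from Lipschitz bounds. The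
    threshold balances [(p - 1) / (2 * m)] against [1 / (4 * m + (2 * pi / L) ^+ 2)]. The resulting
    comparison is linear in [m]: for [p >= 3 / 2] it always favours the constant, and otherwise it
    changes sign at the stated value. *)

Section PointwiseDerive.
Context {R : realType}.
Implicit Types (f g : R -> R) (x a b : R).

Lemma der_cst a x : is_derive x 1 (fun=> a) 0.
Proof. exact: is_derive_cst. Qed.

Lemma der_id x : is_derive x 1 (fun t => t) 1.
Proof. exact: is_derive_id. Qed.

Lemma derD {f g x a b} : is_derive x 1 f a -> is_derive x 1 g b ->
  is_derive x 1 (fun t => f t + g t) (a + b).
Proof. exact: is_deriveD. Qed.

Lemma derB {f g x a b} : is_derive x 1 f a -> is_derive x 1 g b ->
  is_derive x 1 (fun t => f t - g t) (a - b).
Proof. exact: is_deriveB. Qed.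

Lemma derM {f g x a b} : is_derive x 1 f a -> is_derive x 1 g b ->
  is_derive x 1 (fun t => f t * g t) (a * g x + f x * b).
Proof.
move=> df dg; apply: is_derive_eq (is_deriveM df dg) _.
by rewrite addrC [g x *: a]mulrC.
Qed.

Lemma derZ {f x a} c : is_derive x 1 f a ->
  is_derive x 1 (fun t => c * f t) (c * a).
Proof. exact: is_deriveZ. Qed.

Lemma der_comp {f g x a b} : is_derive (g x) 1 f a -> is_derive x 1 g b ->
  is_derive x 1 (fun t => f (g t)) (a * b).
Proof. exact: is_derive1_comp. Qed.

Lemma der_affine k m x : is_derive x 1 (fun t => k * (t - m)) k.
Proof.
apply: is_derive_eq (derZ k (derB (der_id x) (der_cst m x))) _.
by rewrite subr0 mulr1.
Qed.

Lemma is_derive_continuous {f x a} : is_derive x 1 f a -> {for x, continuous f}.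
Proof. by case=> df _; exact/differentiable_continuous/derivable1_diffP. Qed.

End PointwiseDerive.

Section SegmentIntegral.
Context {R : realType}.
Notation mu := (@lebesgue_measure R).
Implicit Types (a b c x y M : R) (f g : R -> R).

Definition sint a b f : R := \int[mu]_(t in `[a, b]) f t.

(** Boundedness rather than mere integrability, since the energy estimates multiply these functions
    freely: the class is an algebra inside the integrable functions. *)
Definition bmf a b f :=
  measurable_fun `[a, b]%classic f /\
  exists M, forall x, a <= x <= b -> `|f x| <= M.

Lemma bmf_cst a b c : bmf a b (fun=> c).
Proof. by split; [exact: measurable_cst | exists `|c|]. Qed.

Lemma bmfD {a b f g} : bmf a b f -> bmf a b g -> bmf a b (fun x => f x + g x).
Proof.
move=> [mf [M fM]] [mg [N gN]]; split; first exact: measurable_funD.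
by exists (M + N) => x xab; rewrite (le_trans (ler_normD _ _))// lerD ?fM ?gN.
Qed.

Lemma bmfM {a b f g} : bmf a b f -> bmf a b g -> bmf a b (fun x => f x * g x).
Proof.
move=> [mf [M fM]] [mg [N gN]]; split; first exact: measurable_funM.
by exists (M * N) => x xab; rewrite normrM ler_pM ?fM ?gN.
Qed.

Lemma bmfN {a b f} : bmf a b f -> bmf a b (fun x => - f x).
Proof.
move=> [mf [M fM]]; split; first exact: measurable_funN.
by exists M => x xab; rewrite normrN fM.
Qed.

Lemma bmfB {a b f g} : bmf a b f -> bmf a b g -> bmf a b (fun x => f x - g x).
Proof. by move=> bf bg; exact: (bmfD bf (bmfN bg)). Qed.

Lemma bmfX {a b f} n : bmf a b f -> bmf a b (fun x => f x ^+ n).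
Proof.
move=> bf; elim: n => [|n IH]; first exact: bmf_cst.
by under eq_fun do rewrite exprS; exact: bmfM.
Qed.

Lemma bmf_norm {a b f} : bmf a b f -> bmf a b (fun x => `|f x|).
Proof.
move=> [mf [M fM]]; split; first exact: measurableT_comp.
by exists M => x xab; rewrite normr_id fM.
Qed.

Lemma bmf_continuous {a b f} : {within `[a, b], continuous f} -> bmf a b f.
Proof.
move=> cf; split.
  by apply: subspace_continuous_measurable_fun => //; exact: measurable_itv.
have [M [_ HM]] := compact_bounded (continuous_compact cf (@segment_compact _ a b)).
exists (M + 1) => x xab; apply: (HM _ _ (f x)); first by rewrite ltrDl.
by exists x => //=; rewrite in_itv.
Qed.

Lemma bmf_sub {a b f} c d : a <= c -> d <= b -> bmf a b f -> bmf c d f.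
Proof.
move=> ac db [mf [M fM]]; split.
  apply: measurable_funS mf => //; apply: subset_itv; rewrite bnd_simp//.
by exists M => x /andP[cx xd]; rewrite fM// (le_trans ac) ?(le_trans xd).
Qed.

Lemma bmf_eq {a b f} g : (forall x, a <= x <= b -> f x = g x) ->
  bmf a b f -> bmf a b g.
Proof.
move=> fg [mf [M fM]]; split.
  by apply: eq_measurable_fun mf => x /[!inE]/=; rewrite in_itv/= => /fg.
by exists M => x xab; rewrite -fg// fM.
Qed.

Lemma bmf_integrable {a b f} : bmf a b f -> mu.-integrable `[a, b] (EFin \o f).
Proof.
move=> [mf [M fM]]; apply: measurable_bounded_integrable => //.
  by rewrite /= lebesgue_measure_itv/= lte_fin; case: ifP => // _; rewrite -EFinB ltry.
exists M; split; first exact: num_real.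
move=> N MN x /=; rewrite in_itv/= => xab; exact: le_trans (fM x xab) (ltW MN).
Qed.

Lemma eq_int {a b f} g : (forall x, a <= x <= b -> f x = g x) ->
  sint a b f = sint a b g.
Proof.
by move=> fg; apply: eq_Rintegral => x /[!inE]/=; rewrite in_itv/= => /fg.
Qed.

Lemma intD {a b f g} : bmf a b f -> bmf a b g ->
  sint a b (fun x => f x + g x) = sint a b f + sint a b g.
Proof. by move=> bf bg; apply: RintegralD => //; exact: bmf_integrable. Qed.

Lemma intB {a b f g} : bmf a b f -> bmf a b g ->
  sint a b (fun x => f x - g x) = sint a b f - sint a b g.
Proof. by move=> bf bg; apply: RintegralB => //; exact: bmf_integrable. Qed.

Lemma intZ {a b f} c : bmf a b f ->
  sint a b (fun x => c * f x) = c * sint a b f.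
Proof. by move=> bf; apply: RintegralZl => //; exact: bmf_integrable. Qed.

Lemma int_cst a b c : a <= b -> sint a b (fun=> c) = c * (b - a).
Proof.
move=> ab; rewrite /sint Rintegral_cst//= lebesgue_measure_itv/= lte_fin.
case: ltP => [//|ba]; by rewrite (_ : b = a) ?subrr//; apply/le_anti/andP; split.
Qed.

Lemma le_int {a b f g} : bmf a b f -> bmf a b g ->
  (forall x, a <= x <= b -> f x <= g x) -> sint a b f <= sint a b g.
Proof.
move=> bf bg fg; apply: le_Rintegral => //;  exact: bmf_integrable.

Qed.

Lemma int_ge0 {a b f} : (forall x, a <= x <= b -> 0 <= f x) -> 0 <= sint a b f.
Proof. by move=> f0; apply: Rintegral_ge0 => x /=; rewrite in_itv/= => /f0. Qed.

Lemma norm_int {a b f} : bmf a b f -> `|sint a b f| <= sint a b (fun x => `|f x|).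
Proof. by move=> bf; apply: le_normr_Rintegral => //; exact: bmf_integrable. Qed.

Lemma norm_int_le {a b f M} : a <= b -> bmf a b f ->
  (forall x, a <= x <= b -> `|f x| <= M) -> `|sint a b f| <= M * (b - a).
Proof.
move=> ab bf fM; rewrite (le_trans (norm_int bf))// -int_cst//.
by apply: le_int => //; [exact: bmf_norm | exact: bmf_cst].
Qed.

Lemma int_split {a b f} c : a <= c <= b -> bmf a b f ->
  sint a b f = sint a c f + sint c b f.
Proof.
move=> /andP[ac cb] bf.
have := @Rintegral_itvB R f (BLeft a) (BRight b) c (bmf_integrable bf).
rewrite !bnd_simp => /(_ ac cb).
rewrite Rintegral_itv_obnd_cbnd; first by rewrite /sint => <-; rewrite addrC subrK.
apply: integrableS (bmf_integrable bf) => //.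
by apply: subset_itvr; rewrite bnd_simp.
Qed.

Lemma int_pt a f : sint a a f = 0.
Proof. by rewrite /sint set_itv1 Rintegral_set1. Qed.

(* [f] is absolutely continuous on [a, b], with bounded a.e. derivative [f1] *)
Definition prim a b f f1 :=
  bmf a b f1 /\
  forall x y, a <= x -> x <= y -> y <= b -> f y - f x = sint x y f1.

Lemma prim_lipschitz {a b f f1} : prim a b f f1 ->
  exists2 M, 0 <= M & forall x y, a <= x -> x <= y -> y <= b ->
    `|f y - f x| <= M * (y - x).
Proof.
move=> [bf1 ff1]; have [_ [M f1M]] := bf1; exists `|M| => // x y ax xy yb.
rewrite ff1// norm_int_le//; first exact: bmf_sub bf1.
move=> z /andP[xz zy]; rewrite (le_trans _ (ler_norm M))// f1M//.
by rewrite (le_trans ax xz) (le_trans zy yb).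
Qed.

Lemma lipschitz_continuous {a b M f} : 0 <= M ->
  (forall x y, a <= x -> x <= y -> y <= b -> `|f y - f x| <= M * (y - x)) ->
  {within `[a, b], continuous f}.
Proof.
move=> M0 fM.
have fM' x y : a <= x <= b -> a <= y <= b -> `|f y - f x| <= M * `|y - x|.
  move=> /andP[ax xb] /andP[ay yb]; have [xy|/ltW yx] := leP x y.
    by rewrite (ger0_norm (_ : 0 <= y - x)) ?subr_ge0// fM.
  by rewrite distrC [`|y - x|]distrC (ger0_norm (_ : 0 <= x - y)) ?subr_ge0// fM.
apply/subspace_continuousP => x; rewrite /= in_itv/= => xab.
apply/cvgrPdist_le => e e0; near=> y.
have yab : a <= y <= b.
  by have : `[a, b]%classic y; [near: y; exact: withinT | rewrite /= in_itv].
rewrite (le_trans (fM' _ _ yab xab))//.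
have : `|x - y| <= e / (M + 1).
  near: y; apply: cvg_within; apply: (@cvgr_dist_le _ _ _ (nbhs x) _ id x); first exact: cvg_id.
  by rewrite divr_gt0// ltr_wpDl.
rewrite ler_pdivlMr ?ltr_wpDl// mulrDr mulr1 mulrC.
by apply: le_trans; rewrite lerDl normr_ge0.
Unshelve. all: by end_near. Qed.

Lemma prim_continuous {a b f f1} : prim a b f f1 ->
  {within `[a, b], continuous f}.
Proof. by move=> /prim_lipschitz[M M0]; exact: lipschitz_continuous. Qed.

Lemma prim_bmf {a b f f1} : prim a b f f1 -> bmf a b f.
Proof. by move=> pf; apply: bmf_continuous; exact: prim_continuous pf. Qed.

Lemma prim_sub {a b f f1} c d : a <= c -> d <= b ->
  prim a b f f1 -> prim c d f f1.
Proof.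
move=> ac db [bf1 ff1]; split; first exact: bmf_sub bf1.
by move=> x y cx xy yd; rewrite ff1// ?(le_trans ac) ?(le_trans yd).
Qed.

Lemma primE {a b f f1} : a <= b -> prim a b f f1 -> sint a b f1 = f b - f a.
Proof. by move=> ab [_ <-]. Qed.

Lemma prim_eq {a b f f1} g g1 : (forall x, a <= x <= b -> f x = g x) ->
  (forall x, a <= x <= b -> f1 x = g1 x) -> prim a b f f1 -> prim a b g g1.
Proof.
move=> fg fg1 [bf1 ff1]; split; first exact: bmf_eq bf1.
move=> x y ax xy yb; rewrite -!fg ?ax ?yb ?(le_trans ax) ?(le_trans xy)// ff1//.
by apply: eq_int => z /andP[xz zy]; rewrite fg1// (le_trans ax)// (le_trans zy).
Qed.

Lemma prim_cst a b c : prim a b (fun=> c) (fun=> 0).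
Proof.
split; first exact: bmf_cst.
by move=> x y _ xy _; rewrite int_cst// mul0r subrr.
Qed.

Lemma primD {a b f f1 g g1} : prim a b f f1 -> prim a b g g1 ->
  prim a b (fun x => f x + g x) (fun x => f1 x + g1 x).
Proof.
move=> [bf ff] [bg gg]; split; first exact: bmfD.
move=> x y ax xy yb.
by rewrite (intD (bmf_sub _ _ ax yb bf) (bmf_sub _ _ ax yb bg)) -ff// -gg// opprD addrACA.
Qed.

(** Cutting the segment into [n] equal pieces bounds the total increment by
    [n * M * ((b - a) / n) ^+ 2], which tends to 0. *)
Lemma increments_sq_le_cst {a b M} (F : R -> R) : a <= b ->
  (forall x y, a <= x -> x <= y -> y <= b -> `|F y - F x| <= M * (y - x) ^+ 2) ->
  F b = F a.
Proof.
move=> ab FM; apply/eqP; rewrite -subr_eq0 -normr_le0; apply/ler_addgt0Pl => e e0.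
rewrite addr0.
have M0 : 0 <= M * (b - a) ^+ 2 by apply: le_trans (FM _ _ (lexx _) ab (lexx _)).
have [n nM] : exists n : nat, M * (b - a) ^+ 2 / e < n%:R.
  exists (Num.bound (M * (b - a) ^+ 2 / e)).
  by have := archi_boundP (divr_ge0 M0 (ltW e0)).
have n0 : 0 < n%:R :> R by apply: le_lt_trans nM; rewrite divr_ge0 ?(ltW e0).
pose h := (b - a) / n%:R.
have h0 : 0 <= h by rewrite divr_ge0 ?subr_ge0.
have nh : n%:R * h = b - a by rewrite mulrC divfK ?gt_eqF.
have step k : (k <= n)%N -> `|F (a + k%:R * h) - F a| <= k%:R * (M * h ^+ 2).
  elim: k => [|k IH] kn; first by rewrite !mul0r addr0 subrr normr0.
  have -> : F (a + k.+1%:R * h) - F a =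
    (F (a + k.+1%:R * h) - F (a + k%:R * h)) + (F (a + k%:R * h) - F a).
    by rewrite addrA subrK.
  have kh : k.+1%:R * h = k%:R * h + h by rewrite -natr1 mulrDl mul1r.
  have le1 : a <= a + k%:R * h by rewrite lerDl mulr_ge0.
  have le2 : a + k%:R * h <= a + k.+1%:R * h by rewrite kh addrA lerDl.
  have le3 : a + k.+1%:R * h <= b.
    by rewrite addrC -lerBrDr -nh ler_wpM2r// ler_nat.
  have := FM _ _ le1 le2 le3.
  rewrite [X in M * X ^+ 2](_ : _ = h); last by rewrite kh; ring.
  move=> /lerD /(_ (IH (ltnW kn))) /(le_trans (ler_normD _ _)).
  have -> : k.+1%:R * (M * h ^+ 2) = M * h ^+ 2 + k%:R * (M * h ^+ 2).
    by rewrite -natr1; ring.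
  exact.
have := step n (leqnn n); rewrite nh [a + _]addrC subrK => /le_trans; apply.
have -> : n%:R * (M * h ^+ 2) = (M * (b - a) ^+ 2) / n%:R.
  by rewrite /h; field; rewrite gt_eqF.
by rewrite ler_pdivrMr// [leRHS]mulrC -ler_pdivrMr// ltW.
Qed.

(* The increments of [f * g - \int (f1 * g + f * g1)] are quadratically small, so
   this function is constant; no differentiation theorem is needed. *)
Lemma primM {a b f f1 g g1} : prim a b f f1 -> prim a b g g1 ->
  prim a b (fun x => f x * g x) (fun x => f1 x * g x + f x * g1 x).
Proof.
move=> pf pg; have bf := prim_bmf pf; have bg := prim_bmf pg.
have [M M0 lf] := prim_lipschitz pf; have [N N0 lg] := prim_lipschitz pg.
case: (pf) => bf1 ff1; case: (pg) => bg1 gg1.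
have bh : bmf a b (fun x => f1 x * g x + f x * g1 x).
  by apply: bmfD; exact: bmfM.
split=> // x y ax xy yb.
have [_ [M' f1M']] := bf1; have [_ [N' g1N']] := bg1.
pose h z := f1 z * g z + f z * g1 z.
pose F z := f z * g z - sint x z h.
suff : F y = F x by rewrite /F int_pt subr0 => <-; rewrite /h; ring.
apply: (@increments_sq_le_cst _ _ (M * N' + N * M')) => // s t xs st ty.
have as_ : a <= s by exact: le_trans xs.
have tb : t <= b by exact: le_trans yb.
have sub k : bmf a b k -> bmf s t k by exact: bmf_sub.
(* Freezing [f] at the right end and [g] at the left end writes the increment of [f * g] as an
   integral; after subtraction of [h], the factors [f t - f z] and [g s - g z] are of size [t - s]
   by the Lipschitz bounds. *)
have -> : F t - F s =
    sint s t (fun z => (f t - f z) * g1 z + (g s - g z) * f1 z).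
  rewrite /F (@int_split x t _ s) ?xs//; last exact: bmf_sub bh.
  rewrite [RHS](@eq_int _ _ _ (fun z => (f t * g1 z + g s * f1 z) - h z)); last first.
    by move=> z _; rewrite /h; ring.
  rewrite [RHS](@intB _ _ _ h); [|by apply: sub; apply: bmfD; apply: bmfM => //; exact: bmf_cst
                 |exact: sub].
  rewrite (@intD _ _ (fun z => f t * g1 z) (fun z => g s * f1 z));
                 [|by apply: sub; apply: bmfM => //; exact: bmf_cst
                 |by apply: sub; apply: bmfM => //; exact: bmf_cst].
  rewrite !intZ; [|exact: sub|exact: sub].
  by rewrite -ff1// -gg1//; ring.
rewrite expr2 mulrA; apply: norm_int_le => //.
  by apply: sub; apply: bmfD; apply: bmfM => //; apply: bmfB => //; exact: bmf_cst.
move=> z /andP[sz zt].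
have az : a <= z by exact: le_trans sz.
have zb : z <= b by exact: le_trans tb.
rewrite (le_trans (ler_normD _ _))// !normrM [`|g s - _|]distrC.
have := lf _ _ az zt tb; have := lg _ _ as_ sz zb.
have := f1M' z; rewrite az zb => /(_ isT) h1.
have := g1N' z; rewrite az zb => /(_ isT) h2 h3 h4.
have h3' : `|g z - g s| <= N * (t - s) by rewrite (le_trans h3)// ler_wpM2l// lerD2r.
have h4' : `|f t - f z| <= M * (t - s) by rewrite (le_trans h4)// ler_wpM2l// lerD2l lerN2.
have -> : (M * N' + N * M') * (t - s) = (M * (t - s)) * N' + (N * (t - s)) * M' by ring.
by apply: lerD; apply: ler_pM.
Qed.

Lemma prim_is_derive {a b f f1} :
  (forall x, a <= x <= b -> is_derive x 1 f (f1 x)) ->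
  {within `[a, b], continuous f1} -> prim a b f f1.
Proof.
move=> df cf1; split; first exact: bmf_continuous.
move=> x y ax xy yb.
move: xy; rewrite le_eqVlt => /predU1P[->|xy]; first by rewrite int_pt subrr.
have dxy z : x <= z <= y -> is_derive z 1 f (f1 z).
  by move=> /andP[xz zy]; apply: df; rewrite (le_trans ax)// (le_trans zy).
have cf z : x <= z <= y -> {for z, continuous f}.
  by move=> /dxy[dfz _]; apply/differentiable_continuous/derivable1_diffP.
rewrite /sint /Rintegral (@continuous_FTC2 _ _ f)//.
- apply: continuous_subspaceW cf1; apply: subset_itv; rewrite bnd_simp//.
- split.
  + by move=> z; rewrite in_itv/= => /andP[xz zy]; have [] := dxy z; rewrite ?ltW.
  + by apply: cvg_at_right_filter; apply: cf; rewrite lexx ltW.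
  + by apply: cvg_at_left_filter; apply: cf; rewrite lexx ltW.
- move=> z; rewrite in_itv/= => /andP[xz zy].
  by rewrite derive1E; have [] := dxy z; rewrite ?ltW.
Qed.

Lemma int_sub_le {a b f} c d : bmf a b f -> (forall x, a <= x <= b -> 0 <= f x) ->
  a <= c -> c <= d -> d <= b -> sint c d f <= sint a b f.
Proof.
move=> bf f0 ac cd db.
have ad : a <= d by exact: le_trans cd.
rewrite (@int_split a b f d) ?ad// (@int_split a d f c) ?ac//; last first.
  exact: bmf_sub bf.
rewrite -addrA addrCA lerDl addr_ge0// int_ge0// => x /andP[h1 h2]; apply: f0.
  by rewrite h1 (le_trans h2) ?(le_trans cd).
by rewrite h2 (le_trans ad).
Qed.

End SegmentIntegral.

Ltac bm := solve [repeat first [assumption | exact: bmf_cst | exact: prim_bmf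
  | apply: bmfX | apply: bmfB | apply: bmfD | apply: bmfN | apply: bmfM]].

(** * Energy identity and the Wirtinger inequality *)

Section Energy.
Context {R : realType}.
Implicit Types (a b c m x L M k : R) (f g : R -> R).

(* Test the equation against [f1] itself: by periodicity [c], [f] and [f ^+ 2] are
   orthogonal to it. *)
Lemma energy_identity {L lambda sigma c f f1 g} : 0 <= L ->
  prim 0 L f f1 -> f L = f 0 -> bmf 0 L g ->
  (forall t, 0 <= t <= L ->
    f1 t = c - 2 * lambda * f t - sigma * f t ^+ 2 - g t) ->
  sint 0 L (fun t => f1 t ^+ 2) = - sint 0 L (fun t => f1 t * g t).
Proof.
move=> L0 pf fL bg f1E; have bf := prim_bmf pf; have bf1 := pf.1.
have pf2 := primM pf pf; have pf3 := primM pf2 pf.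
have E1 : sint 0 L f1 = 0 by rewrite (primE L0 pf) fL subrr.
have E2 : 2 * sint 0 L (fun t => f t * f1 t) = 0.
  rewrite -intZ; last bm.
  rewrite -[RHS](subrr (f 0 * f 0)) -{1 2}fL -(primE L0 pf2).
  by apply: eq_int => t _; ring.
have E3 : 3 * sint 0 L (fun t => f t ^+ 2 * f1 t) = 0.
  rewrite -intZ; last bm.
  rewrite -[RHS](subrr (f 0 * f 0 * f 0)) -{1 2 3}fL -(primE L0 pf3).
  by apply: eq_int => t _; ring.
have {}E2 : sint 0 L (fun t => f t * f1 t) = 0 by lra.
have {}E3 : sint 0 L (fun t => f t ^+ 2 * f1 t) = 0 by lra.
rewrite (@eq_int _ _ _ _ (fun t => c * f1 t - (2 * lambda) * (f t * f1 t)
   - sigma * (f t ^+ 2 * f1 t) - f1 t * g t)); last first.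
  by move=> t tL; rewrite expr2 [X in _ * X]f1E//; ring.
rewrite intB; [|bm|bm]; rewrite intB; [|bm|bm]; rewrite intB; [|bm|bm].
rewrite !intZ; [|bm|bm|bm].
by rewrite E1 E2 E3; ring.
Qed.

(** Expand [(f + g) ^+ 2 >= 0]: by the identity the cross term equals [- 2] times the integral of
    [f ^+ 2]. *)
Lemma int_sq_le {L f g} : bmf 0 L f -> bmf 0 L g ->
  sint 0 L (fun t => f t ^+ 2) = - sint 0 L (fun t => f t * g t) ->
  sint 0 L (fun t => f t ^+ 2) <= sint 0 L (fun t => g t ^+ 2).
Proof.
move=> bf bg fE.
have : 0 <= sint 0 L (fun t => (f t + g t) ^+ 2) by apply: int_ge0 => t _; exact: sqr_ge0.
rewrite (@eq_int _ _ _ _ (fun t => f t ^+ 2 + 2 * (f t * g t) + g t ^+ 2)); last first.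
  by move=> t _; ring.
rewrite intD; [|bm|bm]; rewrite intD; [|bm|bm]; rewrite intZ; last bm.
by rewrite fE; lra.
Qed.

(** Cauchy-Schwarz against the constant 1, through [2 * N * |f| <= f ^+ 2 + N ^+ 2]. Enlarging [M]
    to [N = M + e / L] keeps the divisor positive when [M = 0]. *)
Lemma int_norm_le {L M f} : 0 < L -> 0 <= M -> bmf 0 L f ->
  sint 0 L (fun t => f t ^+ 2) <= L * M ^+ 2 ->
  sint 0 L (fun t => `|f t|) <= L * M.
Proof.
move=> L0 M0 bf fM; apply/ler_addgt0Pl => e e0.
pose N := M + e / L.
have eL : 0 < e / L by exact: divr_gt0.
have N0 : 0 < N by rewrite ltr_wpDl.
have -> : e + L * M = L * N by rewrite /N; field; rewrite gt_eqF.
rewrite -(ler_pM2l (_ : 0 < 2 * N)) ?mulr_gt0//.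
have -> : 2 * N * (L * N) = L * N ^+ 2 + (N ^+ 2 * (L - 0)) by ring.
have bnf := bmf_norm bf.
rewrite -intZ//.
apply: (@le_trans _ _ (sint 0 L (fun t => f t ^+ 2 + N ^+ 2))).
  apply: le_int; [bm|bm|move=> t _].
  have := sqr_ge0 (`|f t| - N).
  by rewrite -(real_normK (num_real (f t))); lra.
rewrite intD; [|bm|bm]; rewrite int_cst ?(ltW L0)//.
rewrite lerD2r (le_trans fM)// ler_pM2l// lerXn2r ?nnegrE ?(ltW N0)//.
by rewrite lerDl ltW.
Qed.

(** As [f] has mean zero, [L * f x] is the integral of [f x - f t] over [t], and each such
    difference is at most the total variation, itself at most [L * M]. *)
Lemma mean_zero_sup {L M f f1} : 0 < L -> 0 <= M -> prim 0 L f f1 ->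
  sint 0 L f = 0 -> sint 0 L (fun t => f1 t ^+ 2) <= L * M ^+ 2 ->
  forall x, 0 <= x <= L -> `|f x| <= L * M.
Proof.
move=> L0 M0 pf f0 f1M x /andP[x0 xL].
have bf1 := pf.1; have bf := prim_bmf pf; have bnf1 := bmf_norm bf1.
have V := int_norm_le L0 M0 bf1 f1M.
have le_incr s t : 0 <= s -> s <= t -> t <= L -> `|f t - f s| <= L * M.
  move=> s0 st tL; rewrite (pf.2 s t)//.
  rewrite (le_trans (norm_int _))//; first exact: bmf_sub bf1.
  by rewrite (le_trans _ V)// int_sub_le.
have {}le_incr t : 0 <= t <= L -> `|f x - f t| <= L * M.
  move=> /andP[t0 tL]; have [tx|/ltW xt] := leP t x; first exact: le_incr.
  by rewrite distrC le_incr.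
rewrite -(ler_pM2r L0) -[L in leLHS]gtr0_norm// -normrM.
have -> : f x * L = sint 0 L (fun t => f x - f t).
  rewrite intB; [|bm|bm].
  by rewrite int_cst ?(ltW L0)// f0; ring.
by rewrite (le_trans (norm_int_le (ltW L0) _ le_incr)) ?subr0//; bm.
Qed.

(* With [T = k tan(k (x - m))], [T' = k^2 + T^2]; integrate [(f1 + T f)^2 >= 0]. *)
Lemma tan_piece {a b k m f f1} : a <= b -> prim a b f f1 ->
  (forall x, a <= x <= b -> - (pi / 2) < k * (x - m) < pi / 2) ->
  k ^+ 2 * sint a b (fun t => f t ^+ 2) <=
  sint a b (fun t => f1 t ^+ 2)
  + (k * tan (k * (b - m)) * f b ^+ 2 - k * tan (k * (a - m)) * f a ^+ 2).
Proof.
move=> ab pf kpi; have bf := prim_bmf pf; have bf1 := pf.1.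
pose T x := k * tan (k * (x - m)).
have dT x : a <= x <= b -> is_derive x 1 T (k ^+ 2 + T x ^+ 2).
  move=> /kpi /cos_gt0_pihalf cx.
  have /is_derive_tan dt : cos (k * (x - m)) != 0 by rewrite gt_eqF.
  apply: is_derive_eq (derZ k (@der_comp _ tan (fun t => k * (t - m)) _ _ _ dt (der_affine k m x))) _.
  by rewrite cos2_tan2 ?gt_eqF// /T; ring.
have pT : prim a b T (fun x => k ^+ 2 + T x ^+ 2).
  apply: prim_is_derive => //.
  have cT : {within `[a, b], continuous T}.
    apply: continuous_in_subspaceT => x /[!inE]/=; rewrite in_itv/= => /dT.
    exact: is_derive_continuous.
  move=> x; apply: cvgD; first exact: cvg_cst.
  by apply: cvgM; exact: cT.
have bT := prim_bmf pT.
have pTf := primM pT (primM pf pf).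
have : 0 <= sint a b (fun t => (f1 t + T t * f t) ^+ 2).
  by apply: int_ge0 => t _; exact: sqr_ge0.
rewrite (@eq_int _ _ _ _ (fun t => f1 t ^+ 2 +
   ((k ^+ 2 + T t ^+ 2) * (f t * f t) + T t * (f1 t * f t + f t * f1 t))
   - k ^+ 2 * f t ^+ 2)); last by move=> t _; ring.
rewrite intB; [|bm|bm]; rewrite intD; [|bm|bm]; rewrite intZ; last bm.
by rewrite (primE ab pTf) -/(T a) -/(T b); lra.
Qed.

(* [f] takes the same value at some [a] and [a + L / 2]; subtracting it leaves two arcs
   of length [L / 2] with vanishing end values, on each of which [tan_piece] applies
   (the outer arc wraps around [L], where the boundary terms cancel). *)
Lemma wirtinger {L k f f1} : 0 < L -> 0 < k -> k * L < 2 * pi ->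
  prim 0 L f f1 -> f L = f 0 -> sint 0 L f = 0 ->
  k ^+ 2 * sint 0 L (fun t => f t ^+ 2) <= sint 0 L (fun t => f1 t ^+ 2).
Proof.
move=> L0 k0 kL pf fL f0.
have L20 : 0 < L / 2 by lra.
have [a /andP[a0 aL] fa] : exists2 a, 0 <= a <= L / 2 & f (a + L / 2) = f a.
  pose g x := f (x + L / 2) - f x.
  have cg : {within `[0, L / 2], continuous g}.
    have [M M0 lf] := prim_lipschitz pf.
    apply: (@lipschitz_continuous _ _ _ (M + M)); first by rewrite addr_ge0.
    move=> x y x0 xy yL.
    have -> : g y - g x = (f (y + L / 2) - f (x + L / 2)) - (f y - f x).
      by rewrite /g; ring.
    rewrite (le_trans (ler_normB _ _))// mulrDl lerD//; last by apply: lf => //; lra.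
    have -> : y - x = (y + L / 2) - (x + L / 2) by ring.
    by apply: lf; lra.
  (* By periodicity [g (L / 2) = - g 0], so [g] has a zero. *)
  have [|a] := @IVT R g 0 (L / 2) 0 (ltW L20) cg.
    have -> : g (L / 2) = - g 0.
      by rewrite /g add0r (_ : L / 2 + L / 2 = L) ?fL; [ring|field].
    by rewrite ge_min le_max; case: (leP (g 0) 0) => /= h; lra.
  rewrite in_itv/= => h /eqP; rewrite subr_eq0 => /eqP; by exists a.
pose F x := f x + - f a.
have pF : prim 0 L F f1.
  apply: prim_eq (primD pf (prim_cst 0 L (- f a))) => // x _; exact: addr0.
have Fa : F a = 0 by rewrite /F subrr.
have Fa2 : F (a + L / 2) = 0 by rewrite /F fa subrr.
have FL : F L = F 0 by rewrite /F fL.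
have bf := prim_bmf pf; have bF := prim_bmf pF; have bf1 := pf.1.
(* Seen from its midpoint, an arc of length [L / 2] keeps [k * t] within [k * L / 4 < pi / 2]: this
   is where [k * L < 2 * pi] enters. *)
have kpi t : - (L / 4) <= t <= L / 4 -> - (pi / 2) < k * t < pi / 2.
  move=> /andP[t1 t2]; have : k * t <= k * (L / 4) by rewrite ler_pM2l.
  have : k * (- (L / 4)) <= k * t by rewrite ler_pM2l.
  by lra.
have aL' : a + L / 2 <= L by lra.
have a0' : 0 <= a + L / 2 by lra.
have P1 : k ^+ 2 * sint 0 a (fun t => F t ^+ 2) <= sint 0 a (fun t => f1 t ^+ 2)
   - k * tan (k * (0 - (a - L / 4))) * F 0 ^+ 2.
  have := @tan_piece 0 a k (a - L / 4) F f1 a0.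
  rewrite Fa expr0n/= mulr0 sub0r; apply.
    by apply: prim_sub pF; lra.
  by move=> x xa; apply: kpi; lra.
have P2 : k ^+ 2 * sint a (a + L / 2) (fun t => F t ^+ 2) <=
          sint a (a + L / 2) (fun t => f1 t ^+ 2).
  have := @tan_piece a (a + L / 2) k (a + L / 4) F f1.
  rewrite Fa Fa2 expr0n/= !mulr0 subrr addr0; apply; first lra.
    by apply: prim_sub pF; lra.
  by move=> x xa; apply: kpi; lra.
have P3 : k ^+ 2 * sint (a + L / 2) L (fun t => F t ^+ 2) <=
          sint (a + L / 2) L (fun t => f1 t ^+ 2)
          + k * tan (k * (0 - (a - L / 4))) * F 0 ^+ 2.
  have := @tan_piece (a + L / 2) L k (a + 3 * L / 4) F f1 aL'.
  rewrite Fa2 expr0n/= mulr0 subr0 FL.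
  have -> : L - (a + 3 * L / 4) = 0 - (a - L / 4) by field.
  apply.
    by apply: prim_sub pF; lra.
  by move=> x xa; apply: kpi; lra.
have split3 g : bmf 0 L g ->
    sint 0 L g = sint 0 a g + sint a (a + L / 2) g + sint (a + L / 2) L g.
  move=> bg; have i1 : 0 <= a + L / 2 <= L by rewrite a0'.
  have i2 : 0 <= a <= a + L / 2 by rewrite a0 lerDl ltW.
  by rewrite (int_split _ i1 bg) (int_split _ i2 (bmf_sub _ _ (lexx 0) aL' bg)).
have KF : k ^+ 2 * sint 0 L (fun t => F t ^+ 2) <= sint 0 L (fun t => f1 t ^+ 2).
  by rewrite !split3; [lra|bm|bm].
apply: le_trans KF; rewrite ler_wpM2l ?sqr_ge0//.
(* Passing from [f] to [F] can only increase the integral of the square, because the cross term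
   vanishes for [f] of mean zero. *)
have -> : sint 0 L (fun t => F t ^+ 2) = sint 0 L (fun t => f t ^+ 2) + f a ^+ 2 * L.
  rewrite (@eq_int _ _ _ _ (fun t => f t ^+ 2 - (2 * f a) * f t + f a ^+ 2)); last first.
    by move=> t _; rewrite /F; ring.
  rewrite intD; [|bm|bm]; rewrite intB; [|bm|bm]; rewrite intZ; last bm.
  by rewrite int_cst ?(ltW L0)// f0; ring.
by rewrite lerDl mulr_ge0 ?sqr_ge0 ?ltW.
Qed.

End Energy.

(** * The Riccati equation of the logarithmic derivative *)

Section Riccati.
Context {R : realType}.
Implicit Types (f g h w : R -> R) (a b c x L M k lambda C eta : R).
Notation mu := (@lebesgue_measure R).

Lemma antiderivative {f} : continuous f ->
  exists F : R -> R, forall x, is_derive x 1 F (f x).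
Proof.
move=> cf; have bf a b : bmf a b f.
  by apply: bmf_continuous; exact: continuous_subspaceT.
(* [sint x 0 f] with swapped bounds, because [sint a b f] is 0 for [b < a]. *)
exists (fun x => if 0 <= x then sint 0 x f else - sint x 0 f) => x.
(* [a] lies strictly to the left of 0 and of [x], so that near [x] both branches equal the integral
   from [a] minus its part up to 0. *)
pose a := Num.min 0 x - 1.
have [a0 ax] : a < 0 /\ a < x by rewrite /a; case: (leP 0 x) => ?; split; lra.
have xx1 : x < x + 1 by rewrite ltrDl.
have [dF F'] := @continuous_FTC1_closed R f a x (x + 1) xx1
  (bmf_integrable (bf _ _)) ax (cf x).
apply: (@near_eq_is_derive _ _ _ (fun z => sint a z f - sint a 0 f)).
  near=> z; have az : a < z by near: z; exact: lt_nbhsr.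
  case: ifPn => [z0|]; last rewrite -ltNge => z0.
    rewrite (@int_split _ a z f 0) ?(ltW a0)// ?z0//.
    by rewrite addrC addKr.
  rewrite (@int_split _ a 0 f z) ?(ltW az) ?(ltW z0)//.
  by rewrite opprD addNKr.
have dF' : is_derive x 1 (fun z => sint a z f) (f x).
  by apply: DeriveDef; [exact: dF | rewrite -derive1E].
by apply: is_derive_eq (derB dF' (der_cst (sint a 0 f) _)) _; rewrite subr0.
Unshelve. all: by end_near. Qed.

(* The equation satisfied by [w = psi1 / psi] when [b = m + h], with
   [C = - k - lambda ^+ 2 - m]. *)
Definition riccati L lambda h C w :=
  [/\ forall x, w (x + L) = w x, sint 0 L w = 0 &
      forall a b, a <= b ->
        prim a b w (fun t => C - h t - 2 * lambda * w t - w t ^+ 2)].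

Section Apriori.
Context {L lambda C : R} {h w : R -> R}.
Hypothesis L0 : 0 < L.
Hypothesis bh : bmf 0 L h.
Hypothesis rw : riccati L lambda h C w.

Let w1 t := C - h t - 2 * lambda * w t - w t ^+ 2.
Let L0' : 0 <= L. Proof. exact: ltW. Qed.
Let pw : prim 0 L w w1. Proof. by case: rw => _ _ /(_ _ _ L0'). Qed.
Let wL : w L = w 0. Proof. by case: rw => + _ _ => /(_ 0); rewrite add0r. Qed.
Let w0 : sint 0 L w = 0. Proof. by case: rw. Qed.
Let bw : bmf 0 L w. Proof. exact: prim_bmf pw. Qed.
Let bw1 : bmf 0 L w1. Proof. exact: pw.1. Qed.

Lemma riccati_mean : L * C = sint 0 L h + sint 0 L (fun t => w t ^+ 2).
Proof.
have := primE L0' pw; rewrite wL subrr /w1.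
rewrite intB; [|bm|bm]; rewrite intB; [|bm|bm]; rewrite intB; [|bm|bm].
by rewrite intZ// w0 int_cst//; lra.
Qed.

Lemma riccati_energy :
  sint 0 L (fun t => w1 t ^+ 2) <= sint 0 L (fun t => h t ^+ 2).
Proof.
apply: int_sq_le => //; apply: (@energy_identity _ L lambda 1 C w w1 h) => //.
by move=> t _; rewrite /w1; ring.
Qed.

(** The bound involves neither [lambda] nor [C]; the uniformity in [lambda] of the later estimates
    rests on it. *)
Lemma riccati_sup {eta} : (forall x, 0 <= x <= L -> `|h x| <= eta) ->
  forall x, 0 <= x <= L -> `|w x| <= L * eta.
Proof.
move=> heta; have eta0 : 0 <= eta.
  by apply: le_trans (normr_ge0 _) (heta 0 _); rewrite lexx.
apply: (mean_zero_sup L0 eta0 pw w0); apply: (le_trans riccati_energy).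
have -> : L * eta ^+ 2 = eta ^+ 2 * (L - 0) by ring.
rewrite -int_cst//; apply: le_int; [bm|bm|move=> x xL].
by rewrite -(real_normK (num_real (h x))) lerXn2r ?nnegrE// heta.
Qed.

Let ww1 : sint 0 L (fun t => w t * w1 t) = 0.
Proof.
have : 2 * sint 0 L (fun t => w t * w1 t) = 0.
  rewrite -intZ; last bm.
  rewrite -[RHS](subrr (w 0 * w 0)) -{1 2}wL -(primE L0' (primM pw pw)).
  by apply: eq_int => t _; ring.
by lra.
Qed.

Let w2w1 : sint 0 L (fun t => w t ^+ 2 * w1 t) = 0.
Proof.
have : 3 * sint 0 L (fun t => w t ^+ 2 * w1 t) = 0.
  rewrite -intZ; last bm.
  rewrite -[RHS](subrr (w 0 * w 0 * w 0)) -{1 2 3}wL.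
  rewrite -(primE L0' (primM (primM pw pw) pw)).
  by apply: eq_int => t _; ring.
by lra.
Qed.

Lemma int_cube_le {M} : (forall x, 0 <= x <= L -> `|w x| <= M) ->
  `|sint 0 L (fun t => w t ^+ 3)| <= M * sint 0 L (fun t => w t ^+ 2).
Proof.
move=> wM; rewrite (le_trans (norm_int _))//; first bm.
rewrite -intZ; last bm.
apply: le_int; [by apply: bmf_norm; bm|bm|move=> x xL].
by rewrite exprS normrM normrX real_normK ?num_real// ler_wpM2r ?sqr_ge0 ?wM.
Qed.

(* Test against [q = w1 + 2 lambda w], for which [\int q^2 = \int w1^2 + 4 lambda^2
   \int w^2]. *)
Lemma riccati_upper {k M} : 0 <= lambda -> 0 < k -> k * L < 2 * pi ->
  (forall x, 0 <= x <= L -> `|w x| <= M) ->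
  (4 * lambda ^+ 2 + k ^+ 2 - 4 * lambda * M) * sint 0 L (fun t => w t ^+ 2)
  <= sint 0 L (fun t => h t ^+ 2).
Proof.
move=> l0 k0 kL wM; have W := wirtinger L0 k0 kL pw wL w0.
have := int_cube_le wM; rewrite ler_norml => /andP[W3 W3'].
pose q t := w1 t + 2 * lambda * w t.
have bq : bmf 0 L q by rewrite /q; bm.
have q2 : sint 0 L (fun t => q t ^+ 2) =
    sint 0 L (fun t => w1 t ^+ 2) + 4 * lambda ^+ 2 * sint 0 L (fun t => w t ^+ 2).
  rewrite (@eq_int _ _ _ _ (fun t => w1 t ^+ 2 + (4 * lambda) * (w t * w1 t)
    + (4 * lambda ^+ 2) * w t ^+ 2)); last by move=> t _; rewrite /q; ring.
  rewrite intD; [|bm|bm]; rewrite intD; [|bm|bm]; rewrite !intZ; [|bm|bm].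
  by rewrite ww1; ring.
have iq : sint 0 L q = 0.
  by rewrite /q intD; [|bm|bm]; rewrite intZ// w0 (primE L0' pw) wL; ring.
have w2q : sint 0 L (fun t => w t ^+ 2 * q t) = 2 * lambda * sint 0 L (fun t => w t ^+ 3).
  rewrite (@eq_int _ _ _ _ (fun t => w t ^+ 2 * w1 t + (2 * lambda) * w t ^+ 3)).
    by rewrite intD; [|bm|bm]; rewrite intZ; [|bm]; rewrite w2w1; ring.
  by move=> t _; rewrite /q; ring.
have q2' : sint 0 L (fun t => q t ^+ 2) = - sint 0 L (fun t => h t * q t)
    - 2 * lambda * sint 0 L (fun t => w t ^+ 3).
  rewrite (@eq_int _ _ _ _ (fun t => C * q t - h t * q t - w t ^+ 2 * q t)).
    rewrite intB; [|bm|bm]; rewrite intB; [|bm|bm]; rewrite intZ//.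
    by rewrite iq w2q; ring.
  by move=> t _; rewrite expr2 {1}/q /w1; ring.
have : 0 <= sint 0 L (fun t => (q t + h t) ^+ 2) by apply: int_ge0 => t _; exact: sqr_ge0.
rewrite (@eq_int _ _ _ _ (fun t => q t ^+ 2 + 2 * (h t * q t) + h t ^+ 2)); last first.
  by move=> t _; ring.
rewrite intD; [|bm|bm]; rewrite intD; [|bm|bm]; rewrite intZ; last bm.
move=> H.
have : lambda * (- (M * sint 0 L (fun t => w t ^+ 2))) <= lambda * sint 0 L (fun t => w t ^+ 3).
  exact: ler_wpM2l.
by lra.
Qed.

(** Test with [w] itself: the derivative term vanishes and the cubic term is absorbed into [M].
    Unlike the bound by the norm of [h], the right side sees the oscillation of [h] and is small at
    high frequency. *)
Lemma riccati_upper_pairing {M} : (forall x, 0 <= x <= L -> `|w x| <= M) ->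
  (2 * lambda - M) * sint 0 L (fun t => w t ^+ 2) <= - sint 0 L (fun t => h t * w t).
Proof.
move=> /int_cube_le; rewrite ler_norml => /andP[W3 W3'].
have := ww1.
rewrite (@eq_int _ _ _ _ (fun t => C * w t - h t * w t - (2 * lambda) * w t ^+ 2
  - w t ^+ 3)); last by move=> t _; rewrite /w1; ring.
rewrite intB; [|bm|bm]; rewrite intB; [|bm|bm]; rewrite intB; [|bm|bm].
by rewrite !intZ; [|bm|bm]; rewrite w0; lra.
Qed.

End Apriori.

Lemma locally_integrable_continuous {f} : continuous f -> locally_integrable setT f.
Proof.
move=> cf; split; [exact: continuous_measurable_fun|exact: openT|].
move=> K _ cK; have /integrableP[_] := continuous_compact_integrable cK (continuous_subspaceT cf).
by [].
Qed.

End Riccati.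

(** * From the eigenvalue problem to the Riccati equation and back *)

Section Correspondence.
Context {R : realType}.
Implicit Types (f g h w b psi : R -> R) (a c x L M k lambda C eta : R).
Notation mu := (@lebesgue_measure R).

Lemma ae_imply {P Q : R -> Prop} : (forall x, P x -> Q x) ->
  {ae mu, forall x, P x} -> {ae mu, forall x, Q x}.
Proof. by move=> PQ; apply: filterS PQ; exact: (ae_filter_ringOfSetsType mu). Qed.

Lemma ae_imply2 {P Q S : R -> Prop} : (forall x, P x -> Q x -> S x) ->
  {ae mu, forall x, P x} -> {ae mu, forall x, Q x} -> {ae mu, forall x, S x}.
Proof. by move=> PQ; apply: filterS2 PQ; exact: (ae_filter_ringOfSetsType mu). Qed.

Lemma ae_eq_int {a c f g} : measurable_fun setT f -> bmf a c g ->
  {ae mu, forall x, f x = g x} -> sint a c f = sint a c g.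
Proof.
move=> mf [mg _] fg; rewrite /sint /Rintegral; congr fine.
apply: ae_eq_integral => //.
- by apply/measurable_EFinP; exact: measurable_funS mf.
- exact/measurable_EFinP.
- by apply: ae_imply fg => x /= -> _.
Qed.

Lemma locally_integrable_itv {a c f} : locally_integrable setT f ->
  mu.-integrable `[a, c] (EFin \o f).
Proof.
move=> [mf _ foo]; apply/integrableP; split.
  by apply/measurable_EFinP; exact: measurable_funS mf.
by apply: foo => //; exact: segment_compact.
Qed.

Lemma periodic_derive {L f f1} : (forall x, is_derive x 1 f (f1 x)) ->
  (forall x, f (x + L) = f x) -> forall x, f1 (x + L) = f1 x.
Proof.
move=> df fL x.
have : is_derive x 1 (fun t => f (t + L)) (f1 (x + L)).
  apply: is_derive_eq (@der_comp _ f (fun t => t + L) x _ _ (df _)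
    (derD (der_id _) (der_cst L _))) _.
  by rewrite addr0 mulr1.
rewrite (_ : (fun t => f (t + L)) = f); last exact/funext.
by move=> [_ <-]; have [_ <-] := df x.
Qed.

Lemma riccati_of_solution {L lambda b h k} {b0 : R} :
  (forall a c, bmf a c h) -> {ae mu, forall x, b x = b0 + h x} ->
  has_periodic_positive_solution L lambda b k ->
  0 < L -> exists w, riccati L lambda h (- k - lambda ^+ 2 - b0) w.
Proof.
move=> bh bE [psi [psi1 [psi2 [[dpsi lpsi2 psi1E] psiL psi0 eqn]]]] L0.
have cpsi : continuous psi by move=> x; exact: is_derive_continuous (dpsi x).
have cpsi1 a c : a <= c -> {within `[a, c], continuous psi1}.
  move=> ac.
  apply: (@subspace_eq_continuous _ _ _ (fun x => psi1 a + sint a x psi2)).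
    by move=> x /[!inE]/=; rewrite in_itv/= => /andP[ax _]; rewrite /sint -psi1E// addrC subrK.
  have := parameterized_integral_continuous ac (locally_integrable_itv lpsi2).
  by move=> H x; apply: cvgD; [exact: cvg_cst|exact: H].
have bpsi a c : bmf a c psi.
  by apply: bmf_continuous; exact: continuous_subspaceT.
have bpsi1 a c : a <= c -> bmf a c psi1 by move=> /cpsi1/bmf_continuous.
(* [psi2] is only locally integrable, but the equation identifies it almost everywhere with the
   locally bounded [p2], which brings [psi1] into the class [prim]. *)
pose p2 x := psi x * (- k - lambda ^+ 2 - b0 - h x) - 2 * lambda * psi1 x.
have bp2 a c : a <= c -> bmf a c p2.
  by move=> ac; have := bpsi1 _ _ ac; have := bpsi a c; have := bh a c;
     rewrite /p2 => *; bm.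
have p2E : {ae mu, forall x, psi2 x = p2 x}.
  by apply: ae_imply2 bE eqn => x bx; rewrite bx /p2; lra.
have ppsi1 a c : a <= c -> prim a c psi1 p2.
  move=> ac; split=> [|x y ax xy yc]; first exact: bp2.
  rewrite psi1E// -(ae_eq_int _ (bp2 _ _ xy) p2E)//.
  by case: lpsi2.
have ipsi a c : a <= c -> prim a c (fun x => (psi x)^-1) (fun x => - (psi x) ^- 2 * psi1 x).
  move=> ac; apply: prim_is_derive => [x _|].
    have psix : psi x != 0 by rewrite gt_eqF.
    exact: (is_deriveV psix (dpsi x)).
  move=> x; apply: cvgM; last exact: cpsi1.
  apply: cvgN; apply: cvgV; first by rewrite expf_neq0// gt_eqF.
  apply: cvgM; exact: (continuous_subspaceT cpsi).
pose w x := psi1 x / psi x.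
have pw a c : a <= c -> prim a c w
    (fun t => - k - lambda ^+ 2 - b0 - h t - 2 * lambda * w t - w t ^+ 2).
  move=> ac; apply: prim_eq (primM (ppsi1 _ _ ac) (ipsi _ _ ac)) => // x _.
  by rewrite /w /p2; field; rewrite gt_eqF.
exists w; split=> //.
- by move=> x; rewrite /w psiL (periodic_derive dpsi psiL).
(* [w] has mean zero as the derivative of the periodic function [ln psi]. *)
- have : prim 0 L (@ln R \o psi) w.
    apply: prim_is_derive; last exact: prim_continuous (pw _ _ (ltW L0)).
    move=> x _; rewrite /w mulrC; apply: is_derive1_comp.
    exact: is_derive1_ln.
  by move=> /(primE (ltW L0)) ->; rewrite /= -[L]add0r psiL subrr.
Qed.

(** Take [psi = expR W] with [W] a primitive of [w]: mean zero makes [W] periodic, and positivity is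
    automatic. *)
Lemma solution_of_riccati {L lambda h C w} {b0 : R} : 0 < L -> continuous h ->
  riccati L lambda h C w ->
  has_periodic_positive_solution L lambda (fun x => b0 + h x)
    (- (C + lambda ^+ 2 + b0)).
Proof.
move=> L0 ch [wL w0 pw].
have cw : continuous w.
  move=> x; have x1 : x - 1 < x + 1 by lra.
  have /(continuous_within_itvP _ x1)[+ _ _] := prim_continuous (pw _ _ (ltW x1)).
  by apply; rewrite in_itv/=; lra.
have [W dW] := antiderivative cw.
have cW : continuous W by move=> x; exact: is_derive_continuous (dW x).
have WL x : W (x + L) = W x.
  apply/eqP; rewrite -subr_eq0; apply/eqP.
  have H (t : R) : is_derive t 1 (fun s : R => W (s + L) - W s) 0.
    apply: is_derive_eq (derB (@der_comp _ W (fun s => s + L) t _ _ (dW _)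
      (derD (der_id _) (der_cst L _))) (dW t)) _.
    by rewrite addr0 mulr1 wL subrr.
  rewrite (is_derive_0_is_cst x 0 H) add0r -[RHS]w0.
  apply/esym/primE; first exact: ltW.
  by apply: prim_is_derive => // ; exact: continuous_subspaceT.
pose psi x := expR (W x).
have dpsi x : is_derive x 1 psi (w x * psi x).
  by rewrite mulrC; apply: is_derive1_comp.
have cpsi : continuous psi by move=> x; exact: is_derive_continuous (dpsi x).
pose psi1 x := w x * psi x.
(* This is [(w' + w ^+ 2) * psi] with [w'] eliminated through the Riccati equation, so that the
   squares cancel. *)
pose psi2 x := (C - h x - 2 * lambda * w x) * psi x.
exists psi, psi1, psi2; split.
- split=> //.
  + apply: locally_integrable_continuous => x; apply: cvgM; last exact: cpsi.
    apply: cvgB; first by apply: cvgB; [exact: cvg_cst|exact: ch].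
    by apply: cvgM; [exact: cvg_cst|exact: cw].
  + move=> x y xy.
    have ppsi : prim x y psi psi1.
      apply: prim_is_derive => // z; apply: cvgM; exact: continuous_subspaceT.
    have /(primE xy) <- := primM (pw _ _ xy) ppsi.
    by apply: eq_int => z _; rewrite /psi1 /psi2; ring.
- by move=> x; rewrite /psi WL.
- by move=> x; exact: expR_gt0.
- by apply: aeW => x; rewrite /psi1 /psi2; ring.
Qed.

End Correspondence.

(** * Upper bound for the speed near the constant *)

Section Taylor.
Context {R : realType}.
Implicit Types (f g : R -> R) (x t d e r : R).

Lemma is_derive_linear_approx {f x d} : is_derive x 1 f d ->
  forall e, 0 < e -> exists2 eta, 0 < eta &
    forall t, `|t| <= eta -> `|f (x + t) - f x - d * t| <= e * `|t|.
Proof.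
move=> /is_derive1_caratheodory[g [fg cg gx]] e e0.
have /cvgrPdist_le/(_ e e0)/nbhs_ballP[/= eta eta0 H] := cg.
exists (eta / 2); first by rewrite divr_gt0.
move=> t teta; rewrite fg addrAC subrr add0r -mulrBl normrM ler_wpM2r//.
rewrite -gx distrC; apply: H; rewrite /ball/= opprD addrA subrr add0r normrN.
by rewrite (le_lt_trans teta)// ltr_pdivrMr// ltr_pMr// ltr1n.
Qed.

Lemma mean_value_at0 {f f'} {t : R} :
  (forall x, `|x| <= `|t| -> is_derive x 1 f (f' x)) ->
  exists2 c, `|c| <= `|t| & f t - f 0 = f' c * t.
Proof.
move=> df; have cf x : `|x| <= `|t| -> {for x, continuous f}.
  by move=> /df; exact: is_derive_continuous.
have [t0|t0] := leP 0 t.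
  have abs x : 0 <= x <= t -> `|x| <= `|t|.
    by move=> /andP[x0 xt]; rewrite !ger0_norm.
  have [x||c ct ->] := @MVT_segment R f f' 0 t t0.
  - by rewrite in_itv/= => /andP[x0 xt]; apply: df; apply: abs; rewrite !ltW.
  - apply: continuous_in_subspaceT => x /[!inE]/=; rewrite in_itv/= => xt.
    by apply: cf; exact: abs.
  - by exists c; [apply: abs; move: ct; rewrite in_itv|rewrite subr0].
have abs x : t <= x <= 0 -> `|x| <= `|t|.
  by move=> /andP[xt x0]; rewrite !ler0_norm ?lerN2// ltW.
have [x||c ct /eqP] := @MVT_segment R f f' t 0 (ltW t0).
- by rewrite in_itv/= => /andP[x0 xt]; apply: df; apply: abs; rewrite !ltW.
- apply: continuous_in_subspaceT => x /[!inE]/=; rewrite in_itv/= => xt.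
  by apply: cf; exact: abs.
- move=> /eqP E; exists c; first by apply: abs; move: ct; rewrite in_itv.
  by rewrite -[LHS]opprB E sub0r mulrN opprK.
Qed.

(** Mean value theorem for the remainder [g]: its derivative is [r] times the first-order remainder
    of the power [r - 1], which is [o(t)], and the increment contributes one more factor [t]. *)
Lemma powR_taylor2 r e : 0 < e -> exists2 eta, 0 < eta &
  forall t, `|t| <= eta ->
    `|(1 + t) `^ r - (1 + r * t + r * (r - 1) / 2 * t ^+ 2)| <= e * t ^+ 2.
Proof.
move=> e0; have r0 : 0 < `|r| + 1 by rewrite ltr_wpDl.
have d1 := @is_derive1_powR R (r - 1) 1 ltr01.
pose e' := e / (`|r| + 1).
have e'0 : 0 < e' by rewrite divr_gt0.
have re' : `|r| * e' <= e.
  by rewrite /e' mulrCA ger_pMr// ler_pdivrMr// mul1r lerDl.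
have [eta eta0 H] := is_derive_linear_approx d1 _ e'0.
exists (Num.min eta (1 / 2)); first by rewrite lt_min eta0; lra.
move=> t; rewrite le_min => /andP[teta t12].
pose g x := (1 + x) `^ r - (1 + r * x + r * (r - 1) / 2 * x ^+ 2).
pose g' x := r * ((1 + x) `^ (r - 1) - 1 - (r - 1) * x).
have dg x : `|x| <= `|t| -> is_derive x 1 g (g' x).
  move=> xt; have x1 : 0 < 1 + x.
    have : `|x| <= 1 / 2 by exact: le_trans t12.
    by rewrite ler_norml => /andP[]; lra.
  have dp : is_derive x 1 (fun x => (1 + x) `^ r) (r * (1 + x) `^ (r - 1)).
    apply: is_derive_eq (@der_comp _ (fun z => z `^ r) (fun x => 1 + x) x _ _
      (is_derive1_powR _ x1) (derD (der_cst 1 _) (der_id _))) _.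
    by rewrite add0r mulr1.
  have dq : is_derive x 1 (fun x => 1 + r * x + r * (r - 1) / 2 * (x * x))
      (r + r * (r - 1) * x).
    apply: is_derive_eq (derD (derD (der_cst 1 _) (derZ r (der_id _)))
      (derZ (r * (r - 1) / 2) (derM (der_id _) (der_id _)))) _.
    by field.
  by apply: is_derive_eq (derB dp dq) _; rewrite /g'; ring.
have [c ct] := mean_value_at0 dg.
have -> : g 0 = 0 by rewrite /g expr0n/= !mulr0 !addr0 powR1 subrr.
rewrite subr0 -/(g t) => ->.
have := H c (le_trans ct teta).
rewrite powR1 mulr1 => Hc.
rewrite /g' !normrM -(real_normK (num_real t)).
apply: (@le_trans _ _ (`|r| * (e' * `|t|) * `|t|)).
  rewrite ler_wpM2r// ler_wpM2l// (le_trans Hc)// ler_wpM2l//; exact: ltW.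
have -> : `|r| * (e' * `|t|) * `|t| = `|r| * e' * `|t| ^+ 2 by ring.
by rewrite ler_wpM2r.
Qed.

End Taylor.

Section LocalUpperBound.
Context {R : realType}.
Implicit Types (f g h w b : R -> R) (a c x L M k lambda C eta p m s : R).
Notation mu := (@lebesgue_measure R).

(** Serves to pick [k] strictly below [2 * pi / L], as the Wirtinger inequality requires, while a
    strict lower bound on [k ^+ 2] survives. [q] may be negative, hence the maximum with 0. *)
Lemma sqr_interpolation {q r : R} : 0 < r -> q < r ^+ 2 ->
  exists k, [/\ 0 < k, k < r & q < k ^+ 2].
Proof.
move=> r0 qr; pose u := (Num.max q 0 + r ^+ 2) / 2.
have r20 : 0 < r ^+ 2 by rewrite exprn_gt0.
have [qu u0 ur] : [/\ q < u, 0 < u & u < r ^+ 2].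
  by rewrite /u; case: (leP q 0) => q0; split; lra.
exists (Num.sqrt u); split; first by rewrite sqrtr_gt0.
  by rewrite -[r]gtr0_norm// -sqrtr_sqr ltr_sqrt.
by rewrite sqr_sqrtr// ltW.
Qed.

Lemma bmf_powR {a c f} p : 0 <= p -> (forall x, a <= x <= c -> 0 <= f x) ->
  bmf a c f -> bmf a c (fun x => f x `^ p).
Proof.
move=> p0 f0 [mf [M fM]]; split.
  by apply: (measurableT_comp (measurable_powR p)).
exists (M `^ p) => x xac; have fx := f0 x xac.
have fxM : f x <= M by rewrite (le_trans (ler_norm _)) ?fM.
rewrite ger0_norm ?powR_ge0// ge0_ler_powR// nnegrE//.
exact: le_trans fxM.
Qed.

(** In the second-order expansion of the constraint in [h / m] the constants cancel, which bounds
    the linear term by the quadratic one. *)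
Lemma int_le_of_power_mean {p m : R} : 0 < p -> 0 < m -> forall e, 0 < e ->
  exists2 eta, 0 < eta & forall L h, 0 < L -> bmf 0 L h ->
    (forall x, 0 <= x <= L -> `|h x| <= eta) ->
    sint 0 L (fun x => (m + h x) `^ p) = L * m `^ p ->
    sint 0 L h <= (e - (p - 1) / (2 * m)) * sint 0 L (fun x => h x ^+ 2).
Proof.
move=> p0 m0 e e0.
(* The tolerance is scaled to become [e] once the quadratic term, taken over [m ^+ 2], is divided by
   [p / m]. *)
have [|eta0 eta00 T] := @powR_taylor2 R p (p * m * e); first by rewrite !mulr_gt0.
exists (Num.min (eta0 * m) m); first by rewrite lt_min mulr_gt0.
move=> L h L0 bh heta hE; have L0' := ltW L0.
have mp : 0 < m `^ p by exact: powR_gt0.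
have hb x : 0 <= x <= L -> [/\ `|h x| <= eta0 * m, 0 <= 1 + h x / m & 0 <= m + h x].
  move=> /heta; rewrite le_min => /andP[-> /=].
  rewrite ler_norml => /andP[h1 _].
  have : - 1 <= h x / m by rewrite ler_pdivlMr// mulN1r.
  by split=> //; lra.
pose A : R := p * (p - 1) / 2 - p * m * e.
have lb x : 0 <= x <= L ->
   m `^ p * (1 + p / m * h x + A / m ^+ 2 * h x ^+ 2) <= (m + h x) `^ p.
  move=> /hb[h1 h2 h3].
  have -> : m + h x = m * (1 + h x / m) by field; rewrite gt_eqF.
  rewrite powRM ?(ltW m0)// ler_pM2l//.
  have : `|h x / m| <= eta0.
    by rewrite normrM normfV (gtr0_norm m0) ler_pdivrMr.
  move=> /T; rewrite ler_norml => /andP[+ _].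
  have -> : p * (h x / m) = p / m * h x by ring.
  have -> : (h x / m) ^+ 2 = h x ^+ 2 / m ^+ 2 by rewrite expr_div_n.
  by rewrite /A; lra.
have bp : bmf 0 L (fun x => (m + h x) `^ p).
  by apply: bmf_powR; [exact: ltW|by move=> x /hb[]|bm].
have : sint 0 L (fun x => m `^ p * (1 + p / m * h x + A / m ^+ 2 * h x ^+ 2)) <= L * m `^ p.
  by rewrite -hE; apply: le_int => //; bm.
rewrite intZ; last bm.
rewrite intD; [|bm|bm]; rewrite intD; [|bm|bm]; rewrite !intZ; [|bm|bm].
rewrite int_cst// mulrC ler_pM2r// subr0 mul1r.
set I := sint 0 L h; set J := sint 0 L _ => H.
have : p / m * I + A / m ^+ 2 * J <= 0 by lra.
have -> : p / m * I + A / m ^+ 2 * J = (p / m) * (I - (e - (p - 1) / (2 * m)) * J).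
  by rewrite /A; field; rewrite !gt_eqF.
by rewrite pmulr_rle0 ?divr_gt0// subr_le0.
Qed.

Lemma riccati_const_le {L p m : R} : 0 < L -> 1 < p -> 0 < m ->
  2 * m < (p - 1) * (4 * m + (2 * pi / L) ^+ 2) ->
  exists2 c0 : R, 0 < c0 & exists2 eta, 0 < eta & forall h w C,
    bmf 0 L h -> (forall x, 0 <= x <= L -> `|h x| <= eta) ->
    sint 0 L (fun x => (m + h x) `^ p) = L * m `^ p ->
    riccati L (Num.sqrt m) h C w ->
    L * C <= - c0 * sint 0 L (fun x => h x ^+ 2).
Proof.
move=> L0 p1 m0 cond; set s := Num.sqrt m.
have p10 : 0 < p - 1 by rewrite subr_gt0.
have s0 : 0 < s by rewrite sqrtr_gt0.
have s2 : s ^+ 2 = m by rewrite sqr_sqrtr// ltW.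
have [k [k0 kL kq]] : exists k, [/\ 0 < k, k < 2 * pi / L &
    2 * m / (p - 1) - 4 * m < k ^+ 2].
  apply: sqr_interpolation; first by rewrite divr_gt0// mulr_gt0// pi_gt0.
  by rewrite ltrBlDl ltr_pdivrMr// [ltRHS]mulrC.
(* [D] is the coefficient in the bound on [w] without its cubic loss, and [2 * m / (p - 1)] the
   value that would exactly balance the mean of [h]. The midpoint [D'] leaves [D - D'] for the cubic
   loss; half of the gain [c1] pays for the Taylor error. *)
pose D := 4 * m + k ^+ 2; pose D' := (D + 2 * m / (p - 1)) / 2.
have m2p : 0 < 2 * m / (p - 1) by rewrite divr_gt0// mulr_gt0.
have [DD' D'm] : D' < D /\ 2 * m / (p - 1) < D' by rewrite /D' /D; split; lra.
have D'0 : 0 < D' by lra.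
pose c1 : R := (p - 1) / (2 * m) - D'^-1.
have c10 : 0 < c1.
  rewrite subr_gt0 -[X in _ < X]invf_div ltf_pV2 ?posrE//.
have [eta1 eta10 H1] := @int_le_of_power_mean p m (lt_trans ltr01 p1) m0 (c1 / 2) (divr_gt0 c10 (ltr0Sn _ 1)).
exists (c1 / 2); first by rewrite divr_gt0.
(* The second bound makes the cubic loss [4 * s * M], with [M = L * eta], at most [D - D']. *)
exists (Num.min eta1 ((D - D') / (4 * s * L))).
  by rewrite lt_min eta10 divr_gt0 ?mulr_gt0// subr_gt0.
move=> h w C bh heta hE rw.
have J0 : 0 <= sint 0 L (fun x => h x ^+ 2) by apply: int_ge0 => x _; exact: sqr_ge0.
have W0 : 0 <= sint 0 L (fun x => w x ^+ 2) by apply: int_ge0 => x _; exact: sqr_ge0.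
have HI : sint 0 L h <= (c1 / 2 - (p - 1) / (2 * m)) * sint 0 L (fun x => h x ^+ 2).
  by apply: H1 => // x /heta; rewrite le_min => /andP[].
have wM : forall x, 0 <= x <= L -> `|w x| <= L * ((D - D') / (4 * s * L)).
  by apply: (riccati_sup L0 bh rw) => x /heta; rewrite le_min => /andP[].
have kL2 : k * L < 2 * pi by rewrite -ltr_pdivlMr.
have := riccati_upper L0 bh rw (ltW s0) k0 kL2 wM.
have -> : 4 * s ^+ 2 + k ^+ 2 - 4 * s * (L * ((D - D') / (4 * s * L))) = D'.
  by rewrite s2 -/D; field; rewrite !gt_eqF.
rewrite mulrC -ler_pdivlMr// => HW.
rewrite (riccati_mean L0 bh rw).
have := lerD HI HW; move=> /le_trans; apply.
by rewrite /c1; lra.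
Qed.

End LocalUpperBound.

(** * The minimal speed: bounds, the constant case, rigidity *)

Section Speeds.
Context {R : realType}.
Implicit Types (f g h w b : R -> R) (a c x L M k lambda C eta p m s v : R).
Notation mu := (@lebesgue_measure R).

Lemma Linf_dist_le {f g eta} :
  (Linf_dist f g <= eta%:E)%E <-> {ae mu, forall x, `|f x - g x| <= eta}.
Proof.
have mu0 : (0 < mu [set: R])%E.
  by rewrite -set_itvNyy lebesgue_measure_itv/= addye ?ltry.
rewrite /Linf_dist unlock /Lnorm ifT//; split.
  by move=> /ess_supP; apply: ae_imply => x /=; rewrite lee_fin.
by move=> H; apply/ess_supP; apply: ae_imply H => x /=; rewrite lee_fin.
Qed.

(** Clipping [b - m] to [[- eta, eta]] alters it on a null set only, and gives the bound at every
    point, as [bmf] asks. *)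
Lemma bounded_representative {m eta b} : 0 <= eta -> measurable_fun setT b ->
  {ae mu, forall x, `|m - b x| <= eta} ->
  exists h, [/\ measurable_fun setT h, forall x, `|h x| <= eta &
    {ae mu, forall x, b x = m + h x}].
Proof.
move=> eta0 mb bm; exists (fun x => Num.max (- eta) (Num.min eta (b x - m))).
have hle x : `|Num.max (- eta) (Num.min eta (b x - m))| <= eta.
  by rewrite ler_norml le_max lexx/= ge_max ge_min lexx orTb andbT; lra.
split=> //.
  apply: measurable_maxr; first exact: measurable_cst.
  apply: measurable_minr; first exact: measurable_cst.
  by apply: measurable_funB => //; exact: measurable_cst.
apply: ae_imply bm => x; rewrite distrC ler_norml => /andP[h1 h2].
by rewrite (min_idPr h2) (max_idPr h1) addrC subrK.
Qed.

(* The first case covers the default value 0 of [cstar] and [principal_eigenvalue]: an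
   upper bound on [cstar] needs no existence result. *)
Lemma cstar_cases {L lambda b} : 0 < lambda ->
  cstar L b <= 0 \/ exists2 k, has_periodic_positive_solution L lambda b k &
    cstar L b <= - k / lambda.
Proof.
move=> l0; rewrite /cstar; case: xgetP => [v _ [_ lb]|_]; last by left.
have := lb _ (imageP (fun l => - principal_eigenvalue L l b / l)
   (l0 : [set l : R | 0 < l] lambda)).
rewrite /principal_eigenvalue; case: xgetP => [k _ sk vk|_]; first by right; exists k.
by rewrite oppr0 mul0r; left.
Qed.

Lemma cstar_unique {L b v} : speeds L b v -> lbound (speeds L b) v ->
  cstar L b = v.
Proof.
move=> sv lv; apply: xget_unique => // u [su lu].
by apply/eqP; rewrite eq_le (lu _ sv) (lv _ su).
Qed.

Lemma riccati_zero {L lambda : R} : riccati L lambda (fun=> 0) 0 (fun=> 0).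
Proof.
split=> // [|a c ac]; first by rewrite /sint Rintegral_cst// mul0r.
apply: prim_eq (prim_cst a c 0) => // x _; rewrite /=; ring.
Qed.

Lemma eigenvalue_const {L lambda m k} : 0 < L ->
  has_periodic_positive_solution L lambda (cst m) k <-> k = - (lambda ^+ 2 + m).
Proof.
move=> L0; split=> [sk|->]; last first.
  have := solution_of_riccati (b0 := m) L0 (fun=> @cst_continuous _ _ 0 _) (@riccati_zero L lambda).
  by rewrite add0r (_ : (fun=> m + 0) = cst m)//; apply/funext => x; rewrite addr0.
have b0 a c : bmf a c (fun=> 0 : R) by exact: bmf_cst.
have bE : {ae mu, forall x, cst m x = m + 0} by apply: aeW => x; rewrite addr0.
have [w rw] := riccati_of_solution (b0 := m) b0 bE sk L0.
have h0 x : 0 <= x <= L -> `|(fun=> 0 : R) x| <= 0 by rewrite normr0.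
have w0 x : 0 <= x <= L -> w x = 0.
  by move=> /(riccati_sup L0 (b0 _ _) rw h0); rewrite mulr0 normr_le0 => /eqP.
have := riccati_mean L0 (b0 _ _) rw.
rewrite (@eq_int _ _ _ (fun t => w t ^+ 2) (fun=> 0)); last first.
  by move=> x /w0 ->; rewrite expr0n.
rewrite int_cst ?(ltW L0)// mul0r addr0 => /eqP; rewrite mulf_eq0 gt_eqF//= => /eqP.
by lra.
Qed.

Lemma cstar_const {L m} : 0 < L -> 0 < m -> cstar L (cst m) = 2 * Num.sqrt m.
Proof.
move=> L0 m0; set s := Num.sqrt m.
have s0 : 0 < s by rewrite sqrtr_gt0.
have s2 : s ^+ 2 = m by rewrite sqr_sqrtr// ltW.
have pE l : principal_eigenvalue L l (cst m) = - (l ^+ 2 + m).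
  apply: xget_unique => [|y]; first exact/(eigenvalue_const L0).
  by move=> /(eigenvalue_const L0).
apply: cstar_unique.
  by exists s => //; rewrite pE -s2; field; rewrite gt_eqF.
move=> _ [l /= l0 <-]; rewrite pE opprK ler_pdivlMr// -s2.
by have := sqr_ge0 (l - s); lra.
Qed.

(** At [lambda = sqrt m] the quotient is [(2 * m + C) / sqrt m]. The condition [- 2 * m <= v] makes
    the bound nonnegative, which covers the case [cstar L b <= 0] of [cstar_cases]. *)
Lemma cstar_le_of_riccati {L m} {b h} : 0 < L -> 0 < m ->
  (forall a c, bmf a c h) -> {ae mu, forall x, b x = m + h x} ->
  forall v, (forall w C, riccati L (Num.sqrt m) h C w -> C <= v) -> 
  - 2 * m <= v ->
  cstar L b <= 2 * Num.sqrt m + v / Num.sqrt m.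
Proof.
move=> L0 m0 bh bE v Hv v0; set s := Num.sqrt m.
have s0 : 0 < s by rewrite sqrtr_gt0.
have s2 : s ^+ 2 = m by rewrite sqr_sqrtr// ltW.
have E : 2 * s + v / s = (2 * m + v) / s by rewrite -s2; field; rewrite gt_eqF.
have [c0|[k sk ck]] := @cstar_cases L s b s0.
  by rewrite (le_trans c0)// E divr_ge0 ?(ltW s0)//; lra.
have [w /Hv] := riccati_of_solution (b0 := m) bh bE sk L0.
rewrite s2 => kv; rewrite (le_trans ck)// E ler_pM2r ?invr_gt0//.
by lra.
Qed.

Lemma bmf_bounded {eta h} a c : measurable_fun setT h ->
  (forall x, `|h x| <= eta) -> bmf a c h.
Proof.
move=> mh heta; split; last by exists eta.
exact: measurable_funS mh.
Qed.

Lemma bounded_locally_integrable {eta h} : measurable_fun setT h ->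
  (forall x, `|h x| <= eta) -> locally_integrable setT h.
Proof.
move=> mh heta; split=> //; first exact: openT.
move=> K _ cK; have mK := compact_measurable cK.
have : mu.-integrable K (EFin \o h).
  apply: measurable_bounded_integrable => //.
  - exact: compact_finite_measure.
  - exact: measurable_funS mh.
  - exists eta; split; first exact: num_real.
    by move=> M etaM x _; exact: le_trans (heta x) (ltW etaM).
by move=> /integrableP[_].
Qed.

(** Lebesgue differentiation of the primitive starting at [- n], combined over the countably many
    [n]. *)
Lemma ae_eq0_of_int {eta h} : measurable_fun setT h ->
  (forall x, `|h x| <= eta) -> (forall a c, a <= c -> sint a c h = 0) ->
  {ae mu, forall x, h x = 0}.
Proof.
move=> mh heta h0; have lh := bounded_locally_integrable mh heta.
have H (n : nat) : {ae mu, forall x, - n%:R < x -> h x = 0}.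
  have := @FTC1 R h (BLeft (- n%:R)) (fun y => locally_integrable_itv lh) lh.
  apply: ae_imply => x Hx nx; have [|_ <-] := Hx; first by rewrite /= lte_fin.
  rewrite (_ : (fun x => _) = cst 0) ?derive1_cst//; apply/funext => y.
  have [ny|yn] := leP (- n%:R) y; first exact: h0.
  by rewrite set_itv_ge ?Rintegral_set0// bnd_simp -ltNge.
apply: ae_imply (ae_foralln H) => x /(_ (Num.bound `|x|)); apply.
rewrite ltrNl (le_lt_trans (ler_norm _))// normrN.
exact: archi_boundP.
Qed.

Lemma periodic_reduce {L} : 0 < L -> forall x, exists2 y, 0 <= y <= L &
  forall f, (forall t, f (t + L) = f t) -> f y = f x.
Proof.
move=> L0 x; pose n := Num.floor (x / L).
have /andP[n1 n2] : n%:~R <= x / L < (n + 1)%:~R := floor_itv (x / L).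
exists (x - n%:~R * L).
  have -> : x - n%:~R * L = (x / L - n%:~R) * L by field; rewrite gt_eqF.
  rewrite intrD in n2; rewrite pmulr_lge0// subr_ge0 n1/= ger_pMl//.
  by rewrite lerBlDr addrC ltW.
move=> f fL.
have fn (i : nat) t : f (t + i%:R * L) = f t.
  elim: i t => [|i IH] t; first by rewrite mul0r addr0.
  by rewrite -natr1 mulrDl mul1r addrA fL IH.
case: (n) => i; first by have := fn i (x - i%:R * L); rewrite subrK => ->.
by rewrite NegzE mulrNz mulNr opprK fn.
Qed.

(* [w = 0], so [h] is almost everywhere equal to [C] on the whole line, although the
   hypothesis only concerns one period and [h] is not assumed periodic. *)
Lemma riccati_rigid {L lambda C eta h w} : 0 < L -> measurable_fun setT h ->
  (forall x, `|h x| <= eta) ->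
  riccati L lambda h C w -> sint 0 L (fun x => h x ^+ 2) = 0 ->
  {ae mu, forall x, h x = 0}.
Proof.
move=> L0 mh heta rw h20; have L0' := ltW L0.
have bh a c : bmf a c h by exact: bmf_bounded heta.
have [wL w0 pw] := rw.
have wE x : w x = 0.
  have [y yL <-//] := periodic_reduce L0 x.
  have W0 : sint 0 L (fun t => (C - h t - 2 * lambda * w t - w t ^+ 2) ^+ 2) <= L * 0 ^+ 2.
    by have := riccati_energy L0 (bh 0 L) rw; rewrite h20 expr0n/= mulr0.
  have := mean_zero_sup L0 (lexx 0) (pw _ _ L0') w0 W0 y yL.
  by rewrite mulr0 normr_le0 => /eqP.
have hC : {ae mu, forall x, h x = C}.
  have mg : measurable_fun setT (fun x => C - h x).
    by apply: measurable_funB => //; exact: measurable_cst.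
  have gM x : `|C - h x| <= `|C| + eta.
    by rewrite (le_trans (ler_normB _ _))// lerD2l.
  have : {ae mu, forall x, C - h x = 0}.
    apply: (ae_eq0_of_int mg gM) => a c ac.
    have := primE ac (pw _ _ ac); rewrite !wE subrr => <-.
    by apply: eq_int => x _; rewrite wE expr0n mulr0 !subr0.
  by apply: ae_imply => x /eqP; rewrite subr_eq0 => /eqP.
have C0 : C = 0.
  have : sint 0 L (fun=> C ^+ 2) = 0.
    rewrite -[RHS]h20; apply: ae_eq_int; [exact: measurable_cst|exact: bmfX|].
    by apply: ae_imply hC => x ->.
  rewrite int_cst// subr0 => /eqP; rewrite mulf_eq0 [L == _]gt_eqF// orbF.
  by rewrite sqrf_eq0 => /eqP.
by apply: ae_imply hC => x ->; rewrite C0.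
Qed.

End Speeds.

(** * Strict local maximality below the threshold *)

Section LocalMaximizer.
Context {R : realType}.
Notation mu := (@lebesgue_measure R).
Context {L beta p : R}.
Hypotheses (L0 : 0 < L) (beta0 : 0 < beta) (p1 : 1 < p).
Let m := beta `^ p^-1.
Let p0 : 0 < p. Proof. exact: lt_trans p1. Qed.
Let m0 : 0 < m. Proof. exact: powR_gt0. Qed.

Lemma powR_root : m `^ p = beta.
Proof. by rewrite /m -powRrM mulVf ?gt_eqF// powRr1// ltW. Qed.

Lemma admissible_profile {eta : R} {b : R -> R} : 0 <= eta <= m ->
  admissible p L beta b -> (Linf_dist (cst m) b <= eta%:E)%E ->
  exists h : R -> R, [/\ measurable_fun setT h, forall x, `|h x| <= eta,
    {ae mu, forall x, b x = m + h x} &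
    sint 0 L (fun x => (m + h x) `^ p) = L * m `^ p].
Proof.
move=> /andP[eta0 etam] [[mb _ _] _ _ bp] /Linf_dist_le bm.
have [h [mh heta bE]] := bounded_representative eta0 mb bm.
exists h; split=> //; rewrite powR_root.
have h0 x : 0 <= m + h x.
  by have := heta x; rewrite ler_norml => /andP[+ _]; lra.
have bh : bmf 0 L (fun x => (m + h x) `^ p).
  apply: bmf_powR => //; first exact: ltW.
  by apply: bmfD; [exact: bmf_cst|exact: bmf_bounded heta].
have E : (\int[mu]_(x in `[0%R, L]) (b x `^ p)%:E =
          \int[mu]_(x in `[0%R, L]) ((m + h x) `^ p)%:E)%E.
  apply: ae_eq_integral => //.
  - apply/measurable_EFinP; apply: measurable_funS (measurableT) (@subsetT _ _) _.
    exact: (measurableT_comp (measurable_powR p)).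
  - by apply/measurable_EFinP; have [] := bh.
  - by apply: ae_imply bE => x /= -> _.
move: bp; rewrite E -[X in (_ * X)%E]fineK; last first.
  exact: (integrable_fin_num _ (bmf_integrable bh)).
rewrite -EFinM => -[] <-; rewrite mulrA divff ?mul1r// gt_eqF//.
Qed.

Lemma admissible_const : admissible p L beta (cst m).
Proof.
split.
- by apply: locally_integrable_continuous => x; exact: cst_continuous.
- by apply: aeW.
- by apply: aeW => x; exact: ltW.
- under eq_integral do rewrite /= powR_root.
  rewrite integral_cst//= lebesgue_measure_itv/= lte_fin L0 -EFinB -!EFinM.
  by congr (_%:E); field; rewrite gt_eqF.
Qed.

Lemma cstar_lt_const : 2 * m < (p - 1) * (4 * m + (2 * pi / L) ^+ 2) ->
  exists2 eta : R, 0 < eta & forall b, admissible p L beta b ->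
    (Linf_dist (cst m) b <= eta%:E)%E ->
    cstar L b <= cstar L (cst m) /\
    ((0 < Linf_dist (cst m) b)%E -> cstar L b < cstar L (cst m)).
Proof.
move=> cond.
have [c0 c00 [eta eta0 H]] := riccati_const_le L0 p1 m0 cond.
exists (Num.min eta m); first by rewrite lt_min eta0.
move=> b Ab bm; rewrite cstar_const//.
have s0 : 0 < Num.sqrt m by rewrite sqrtr_gt0.
have etam : 0 <= Num.min eta m <= m by rewrite le_min ge_min lexx orbT !ltW.
have [h [mh heta bE hp]] := admissible_profile etam Ab bm.
have bh a c : bmf a c h by exact: bmf_bounded heta.
have J0 : 0 <= sint 0 L (fun x => h x ^+ 2) by apply: int_ge0 => x _; exact: sqr_ge0.
have upper v : (forall w C, riccati L (Num.sqrt m) h C w -> C <= v) -> - 2 * m <= v ->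
    cstar L b <= 2 * Num.sqrt m + v / Num.sqrt m.
  exact: cstar_le_of_riccati.
have Cle w C : riccati L (Num.sqrt m) h C w ->
    C <= - (c0 / L) * sint 0 L (fun x => h x ^+ 2).
  have hL x : 0 <= x <= L -> `|h x| <= eta.
    by rewrite (le_trans (heta x))// ge_min lexx.
  move=> /(H h w C (bh _ _) hL hp).
  by rewrite mulrC -ler_pdivlMr// => /le_trans; apply; lra.
(* The maximum with [- 2 * m] meets the hypothesis of [cstar_le_of_riccati]; it is harmless, since
   both arguments are nonpositive. *)
pose v := Num.max (- 2 * m) (- (c0 / L) * sint 0 L (fun x => h x ^+ 2)).
have Hv : cstar L b <= 2 * Num.sqrt m + v / Num.sqrt m.
  apply: upper; last by rewrite le_max lexx.
  by move=> w C /Cle Cv; rewrite le_max Cv orbT.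
have c0L : 0 < c0 / L by exact: divr_gt0.
split.
  rewrite (le_trans Hv)// gerDl pmulr_lle0 ?invr_gt0//.
  by rewrite ge_max; apply/andP; split; [|rewrite mulNr oppr_le0 mulr_ge0// ltW]; lra.
(* With a solution at [sqrt m], rigidity makes the second argument of [v] negative. Without one, the
   bound on [C] holds vacuously for [v = - 2 * m], and the speed is at most 0. *)
move=> bpos; have [[w [C rw]]|norw] := pselect (exists w C, riccati L (Num.sqrt m) h C w).
  have J : sint 0 L (fun x => h x ^+ 2) != 0.
    apply/negP => /eqP /(riccati_rigid L0 mh heta rw) h0.
    move: bpos; rewrite ltNge => /negP; apply; apply/Linf_dist_le.
    by apply: ae_imply2 bE h0 => x -> ->; rewrite addr0 subrr normr0.
  apply: (le_lt_trans Hv); rewrite gtrDl pmulr_llt0 ?invr_gt0//.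
  rewrite gt_max; apply/andP; split; first by rewrite mulNr oppr_lt0 mulr_gt0.
  by rewrite mulNr oppr_lt0 mulr_gt0// lt_neqAle eq_sym J.
apply: (@le_lt_trans _ _ (2 * Num.sqrt m + (- 2 * m) / Num.sqrt m)).
  by apply: upper => // w C rw; exfalso; apply: norw; exists w, C.
by rewrite gtrDl pmulr_llt0 ?invr_gt0// mulNr oppr_lt0 mulr_gt0.
Qed.

End LocalMaximizer.

(** * Existence of the principal eigenvalue for small continuous perturbations *)

Section Existence.
Context {R : realType}.
Implicit Types (f g h w u v : R -> R) (a c x y L M k lambda C eta delta : R).

Lemma le0_of_geometric {M x} : (forall n, x <= M / 2 ^+ n) -> x <= 0.
Proof.
move=> H; rewrite leNgt; apply/negP => x0.
have M0 : 0 <= M / x by rewrite divr_ge0 ?(ltW x0)//; have := H 0%N; rewrite expr0 divr1; lra.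
have := archi_boundP M0; set n := Num.bound _ => Mn.
have := H n; rewrite leNgt => /negP; apply.
rewrite ltr_pdivrMr ?exprn_gt0// mulrC -ltr_pdivrMr//.
apply: (lt_le_trans Mn); rewrite -natrX ler_nat.
exact/ltnW/ltn_expl.
Qed.

(** Let [e] be the integrating factor and [c] the mean of [g]. Integrating [(e * f)' = e * (c - g)]
    from [x] to [x + L] for periodic [f] forces the formula for [f], with [E = e L > 1] as
    [lambda > 0]. This value of [c] is the one that gives [f] mean zero. *)
Lemma periodic_linear_solve {L lambda g} : 0 < L -> 0 < lambda ->
  continuous g -> (forall x, g (x + L) = g x) ->
  exists f, [/\ forall x, f (x + L) = f x, sint 0 L f = 0 &
    forall x, is_derive x 1 f (sint 0 L g / L - 2 * lambda * f x - g x)].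
Proof.
move=> L0 l0 cg gL; have L0' := ltW L0.
pose c := sint 0 L g / L; pose u x := c - g x.
have cu : continuous u by move=> x; apply: cvgB; [exact: cvg_cst|exact: cg].
have bg : bmf 0 L g by apply: bmf_continuous; exact: continuous_subspaceT.
pose e x := expR (2 * lambda * x).
have de x : is_derive x 1 e (2 * lambda * e x).
  rewrite mulrC; apply: (@der_comp _ expR (fun x => 2 * lambda * x)).
  by apply: is_derive_eq (derZ (2 * lambda) (der_id x)) _; rewrite mulr1.
have [G dG] : exists G : R -> R, forall x, is_derive x 1 G (e x * u x).
  apply: antiderivative => x; apply: cvgM; last exact: cu.
  exact: is_derive_continuous (de x).
pose E := e L.
have E1 : 0 < E - 1 by rewrite subr_gt0 /E /e expR_gt1 !mulr_gt0.
have eL x : e (x + L) = E * e x by rewrite /e mulrDr expRD mulrC.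
have e0 x : 0 < e x by exact: expR_gt0.
have uL x : u (x + L) = u x by rewrite /u gL.
have dGL x : is_derive x 1 (fun t => G (t + L)) (E * (e x * u x)).
  apply: is_derive_eq (@der_comp _ G (fun t => t + L) x _ _ (dG _)
    (derD (der_id x) (der_cst L x))) _.
  by rewrite eL uL addr0 mulr1 mulrA.
have GL x : G (x + L + L) - G (x + L) = E * (G (x + L) - G x).
  pose H t := G (t + L) - E * G t.
  have dH (t : R) : is_derive t 1 H 0.
    by apply: is_derive_eq (derB (dGL t) (derZ E (dG t))) _; rewrite subrr.
  have := is_derive_0_is_cst (x + L) x dH.
  by rewrite /H; lra.
pose f x := (e x)^-1 * (G (x + L) - G x) / (E - 1).
have df x : is_derive x 1 f (c - 2 * lambda * f x - g x).
  have eN x' : (e x')^-1 = expR (- (2 * lambda) * x').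
    by rewrite /e mulNr expRN.
  have dei : is_derive x 1 (fun t => (e t)^-1) (- (2 * lambda) * (e x)^-1).
    under eq_fun do rewrite eN.
    rewrite eN; apply: is_derive_eq (@der_comp _ expR
      (fun x => - (2 * lambda) * x) x _ _ (is_derive_expR _)
      (derZ (- (2 * lambda)) (der_id x))) _.
    by rewrite mulr1 mulrC.
  apply: is_derive_eq (derM (derM dei (derB (dGL x) (dG x))) (der_cst (E - 1)^-1 x)) _.
  rewrite /f /u; field; rewrite !gt_eqF//.
have fL x : f (x + L) = f x.
  rewrite /f eL GL; field; rewrite !gt_eqF//.
  exact: expR_gt0.
exists f; split=> //.
have cf : continuous f by move=> x; exact: is_derive_continuous (df x).
have bf : bmf 0 L f by apply: bmf_continuous; exact: continuous_subspaceT.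
have /(primE L0') : prim 0 L f (fun x => c - 2 * lambda * f x - g x).
  apply: prim_is_derive => //; apply: continuous_subspaceT => x.
  apply: cvgB; last exact: cg.
  by apply: cvgB; [exact: cvg_cst|apply: cvgM; [exact: cvg_cst|exact: cf]].
have -> : f L = f 0 by have := fL 0; rewrite add0r.
rewrite subrr.
rewrite intB; [|bm|bm]; rewrite intB; [|bm|bm]; rewrite intZ// int_cst//.
rewrite subr0 /c divfK ?gt_eqF// => H.
have : 2 * lambda * sint 0 L f = 0 by lra.
by move=> /eqP; rewrite mulf_eq0 gt_eqF ?mulr_gt0//= => /eqP.
Qed.

(** The energy identity with [sigma = 0]. Neither [lambda] nor [c] enters the bound, so the
    contraction built on it is uniform in [lambda]. *)
Lemma mean_zero_damped_sup {L lambda c M f g} : 0 < L -> 0 <= M ->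
  prim 0 L f (fun x => c - 2 * lambda * f x - g x) ->
  f L = f 0 -> sint 0 L f = 0 -> bmf 0 L g ->
  (forall x, 0 <= x <= L -> `|g x| <= M) ->
  forall x, 0 <= x <= L -> `|f x| <= L * M.
Proof.
move=> L0 M0 pf fL f0 bg gM; apply: (mean_zero_sup L0 M0 pf f0).
have bf := prim_bmf pf; have bf1 := pf.1.
apply: (@le_trans _ _ (sint 0 L (fun t => g t ^+ 2))).
  apply: int_sq_le => //.
  apply: (@energy_identity _ L lambda 0 c f _ g) => //; first exact: ltW.
  by move=> t _; ring.
have -> : L * M ^+ 2 = M ^+ 2 * (L - 0) by ring.
rewrite -int_cst ?(ltW L0)//; apply: le_int; [bm|bm|move=> x xL].
by rewrite -(real_normK (num_real (g x))) lerXn2r ?nnegrE// gM.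
Qed.

(** The difference [d = w - v] solves a linear damped equation with source [2 * (lambda - mu) * v]
    plus a small multiple of [d]. The case [lambda = mu] gives uniqueness of [C], the general case
    its continuity in [lambda]. *)
Lemma riccati_lipschitz {L lambda mu C D eta h w v} : 0 < L -> 0 < eta ->
  8 * L ^+ 2 * eta <= 1 -> bmf 0 L h ->
  (forall x, 0 <= x <= L -> `|h x| <= eta) ->
  riccati L lambda h C w -> riccati L mu h D v ->
  `|C - D| <= 2 * L * eta * `|lambda - mu|.
Proof.
move=> L0 eta0 L8 bh heta rw rv; have L0' := ltW L0.
have wM := riccati_sup L0 bh rw heta; have vM := riccati_sup L0 bh rv heta.
have [wL w0 /(_ _ _ L0') pw] := rw; have [vL v0 /(_ _ _ L0') pv] := rv.
have bw := prim_bmf pw; have bv := prim_bmf pv.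
set Delta := `|lambda - mu|.
have De0 : 0 <= Delta by exact: normr_ge0.
pose d x := w x + (-1) * v x.
have dL : d L = d 0.
  by have := wL 0; have := vL 0; rewrite add0r /d => -> ->.
have d0 : sint 0 L d = 0.
  by rewrite /d intD; [|bm|bm]; rewrite intZ// w0 v0 mulr0 addr0.
pose g x := 2 * (lambda - mu) * v x + (w x + v x) * d x.
have bg : bmf 0 L g by rewrite /g /d; bm.
have pd : prim 0 L d (fun x => (C - D) - 2 * lambda * d x - g x).
  apply: prim_eq (primD pw (primM (prim_cst 0 L (-1)) pv)) => // x _.
  by rewrite /g /d; ring.
(* Self-improvement: a bound [S] on [d] becomes [(Delta + S) / 4] because [8 * L ^+ 2 * eta <= 1].
   Iterated from the crude [2 * L * eta], the initial bound fades geometrically. *)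
have step S : (forall x, 0 <= x <= L -> `|d x| <= S) ->
    forall x, 0 <= x <= L -> `|d x| <= Delta / 4 + S / 4.
  move=> dS x xL; have S0 : 0 <= S by apply: le_trans (dS x xL).
  pose M := 2 * L * eta * Delta + 2 * L * eta * S.
  have M0 : 0 <= M by rewrite addr_ge0// !mulr_ge0// ltW.
  apply: (@le_trans _ _ (L * M)).
    apply: (mean_zero_damped_sup L0 M0 pd dL d0 bg) => // y yL.
    rewrite /g (le_trans (ler_normD _ _))// lerD// normrM.
      rewrite normrM (ger0_norm (_ : 0 <= 2))// -/Delta.
      have := ler_wpM2l (mulr_ge0 (ler0n R 2) De0) (vM y yL); lra.
    apply: ler_pM => //; last exact: dS.
    rewrite (le_trans (ler_normD _ _))//.
    by have := lerD (wM y yL) (vM y yL); lra.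
  have -> : L * M = (8 * L ^+ 2 * eta) * (Delta / 4 + S / 4) by rewrite /M; field.
  by rewrite -[leRHS]mul1r ler_wpM2r// addr_ge0// divr_ge0.
have dDe x : 0 <= x <= L -> `|d x| <= Delta.
  move=> xL; rewrite -subr_le0; apply: (@le0_of_geometric (2 * L * eta)) => n.
  rewrite lerBlDr addrC; elim: n x xL => [|n IH] x xL.
    rewrite expr0 divr1 /d mulN1r (le_trans (ler_normB _ _))//.
    by have := lerD (wM x xL) (vM x xL); lra.
  apply: (le_trans (step _ IH x xL)); rewrite exprS invfM.
  have : 0 <= 2 * L * eta / 2 ^+ n by rewrite divr_ge0 ?mulr_ge0 ?exprn_ge0// ltW.
  by lra.
rewrite -(ler_pM2l L0) -{1}[L]gtr0_norm// -normrM mulrBr.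
rewrite (riccati_mean L0 bh rw) (riccati_mean L0 bh rv) opprD addrACA subrr add0r.
rewrite -intB; [|bm|bm].
apply: (@le_trans _ _ (2 * (L * eta) * Delta * (L - 0))); last by rewrite subr0; lra.
apply: norm_int_le => //; first bm.
move=> x xL; have -> : w x ^+ 2 - v x ^+ 2 = (w x + v x) * d x by rewrite /d; ring.
rewrite normrM ler_pM ?dDe// (le_trans (ler_normD _ _))//.
by have := lerD (wM x xL) (vM x xL); lra.
Qed.

Section FixedPoint.
Context {L lambda eta : R} {h : R -> R}.
Hypotheses (L0 : 0 < L) (l0 : 0 < lambda) (eta0 : 0 < eta).
Hypothesis L8 : 8 * L ^+ 2 * eta <= 1.
Hypotheses (ch : continuous h) (hL : forall x, h (x + L) = h x).
Hypothesis heta : forall x, `|h x| <= eta.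

Let L0' : 0 <= L. Proof. exact: ltW. Qed.
(** Radius of the invariant ball: since [delta ^+ 2 <= eta], the source [h + f ^+ 2] is at most
    [2 * eta], and the damped bound returns [L * (2 * eta) = delta]. *)
Let delta := 2 * L * eta.
Let delta0 : 0 < delta. Proof. by rewrite !mulr_gt0. Qed.
Let delta2 : delta ^+ 2 <= eta.
Proof.
have -> : delta ^+ 2 = (8 * L ^+ 2 * eta) * (eta / 2) by rewrite /delta; field.
by have := ler_wpM2r (ltW eta0) L8; have := eta0; lra.
Qed.

Let mean f := sint 0 L (fun x => h x + f x ^+ 2) / L.

Let admits f := [/\ continuous f, forall x, f (x + L) = f x &
  forall x, `|f x| <= delta].

Let bmfc {f} a c : continuous f -> bmf a c f.
Proof. by move=> cf; apply: bmf_continuous; exact: continuous_subspaceT. Qed.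

(** The square is taken from the old iterate and the damping from the new one, so that the step
    contracts at the same rate for every [lambda > 0]. *)
Let iteration : exists T : (R -> R) -> (R -> R), forall f, admits f ->
  [/\ admits (T f), sint 0 L (T f) = 0 & forall x, is_derive x 1 (T f)
     (mean f - 2 * lambda * T f x - (h x + f x ^+ 2))].
Proof.
suff H f : exists g, admits f -> [/\ admits g, sint 0 L g = 0 &
    forall x, is_derive x 1 g (mean f - 2 * lambda * g x - (h x + f x ^+ 2))].
  by have [T HT] := choice H; exists T.
have [[cf fL fd]|nf] := pselect (admits f); last by exists f.
have cg : continuous (fun x => h x + f x ^+ 2).
  by move=> x; apply: cvgD; [exact: ch|apply: cvgM; exact: cf].
have [|g [gL g0 dg]] := periodic_linear_solve L0 l0 cg; first by move=> x; rewrite hL fL.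
exists g => _; split=> //.
have cgg : continuous g by move=> x; exact: is_derive_continuous (dg x).
split=> // x; have [y yL <-//] := periodic_reduce L0 x.
have pg : prim 0 L g (fun x => mean f - 2 * lambda * g x - (h x + f x ^+ 2)).
  apply: prim_is_derive => //; apply: continuous_subspaceT => z.
  apply: cvgB; last exact: cg.
  by apply: cvgB; [exact: cvg_cst|apply: cvgM; [exact: cvg_cst|exact: cgg]].
have M0 : 0 <= 2 * eta by rewrite mulr_ge0// ltW.
have -> : delta = L * (2 * eta) by rewrite /delta; ring.
apply: (mean_zero_damped_sup L0 M0 pg _ g0 (bmfc _ _ cg)) => //.
  by have := gL 0; rewrite add0r.
move=> z _; rewrite (le_trans (ler_normD _ _))// mulr_natl mulr2n lerD//.
rewrite normrX (le_trans _ delta2)// lerXn2r ?nnegrE ?(ltW delta0)//.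
Qed.

Lemma riccati_exists : exists w C, riccati L lambda h C w.
Proof.
have [T HT] := iteration.
pose u n := iter n T (fun=> 0).
have Au n : admits (u n).
  elim: n => [|n IH]; last by have [] := HT _ IH.
  by split=> // x; [exact: cst_continuous|rewrite normr0 ltW].
have contract f g (D : R) : admits f -> admits g -> (forall x, `|f x - g x| <= D) ->
    forall x, `|T f x - T g x| <= D / 2.
  move=> Af Ag fgD x.
  have [[cTf TfL _] Tf0 dTf] := HT _ Af; have [[cTg TgL _] Tg0 dTg] := HT _ Ag.
  have [cf _ fd] := Af; have [cg _ gd] := Ag.
  have D0 : 0 <= D by apply: le_trans (fgD 0).
  pose d x := T f x - T g x.
  have dL t : d (t + L) = d t by rewrite /d TfL TgL.
  rewrite -/(d x); have [y yL <-//] := periodic_reduce L0 x.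
  pose r x := f x ^+ 2 - g x ^+ 2.
  have cr : continuous r by move=> z; apply: cvgB; apply: cvgM; by [exact: cf|exact: cg].
  have dd (z : R) : is_derive z 1 d ((mean f - mean g) - 2 * lambda * d z - r z).
    by apply: is_derive_eq (derB (dTf z) (dTg z)) _; rewrite /d /r; ring.
  have cd : continuous d by move=> z; exact: is_derive_continuous (dd z).
  have pd : prim 0 L d (fun z => (mean f - mean g) - 2 * lambda * d z - r z).
    apply: prim_is_derive => //; apply: continuous_subspaceT => z.
    apply: cvgB; last exact: cr.
    by apply: cvgB; [exact: cvg_cst|apply: cvgM; [exact: cvg_cst|exact: cd]].
  have M0 : 0 <= 2 * delta * D by rewrite !mulr_ge0// ltW.
  apply: (@le_trans _ _ (L * (2 * delta * D))).
    apply: (mean_zero_damped_sup L0 M0 pd _ _ (bmfc _ _ cr)) => //.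
    - by have := dL 0; rewrite add0r.
    - by rewrite /d intB ?Tf0 ?Tg0 ?subrr//; exact: bmfc.
    - move=> z _; have -> : r z = (f z + g z) * (f z - g z) by rewrite /r; ring.
      rewrite normrM ler_pM// (le_trans (ler_normD _ _))//.
      by have := lerD (fd z) (gd z); lra.
  have -> : L * (2 * delta * D) = (8 * L ^+ 2 * eta) * (D / 2) by rewrite /delta; field.
  by rewrite -[leRHS]mul1r ler_wpM2r// divr_ge0.
have ustep n x : `|u n.+1 x - u n x| <= delta / 2 ^+ n.
  elim: n x => [|n IH] x.
    by rewrite expr0 divr1 [u 0%N x]/= subr0; have [_ _] := Au 1%N.
  have := contract _ _ _ (Au n.+1) (Au n) IH x.
  by rewrite exprSr invfM mulrA.
(* [e n] is the sum of the step bounds [delta / 2 ^+ k] over [k >= n]. *)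
pose e n : R := 2 * delta / 2 ^+ n.
have e0 n : 0 <= e n by rewrite divr_ge0 ?exprn_ge0// mulr_ge0// ltW.
have eS n : e n = e n.+1 + delta / 2 ^+ n.
  by rewrite /e exprS; field; rewrite expf_neq0.
have eSle n : e n.+1 <= e n by rewrite [leRHS]eS lerDl divr_ge0 ?exprn_ge0// ltW.
have upper n (k : nat) x : u (n + k)%N x + e (n + k)%N <= u n x + e n.
  elim: k => [|k IH]; first by rewrite addn0.
  rewrite addnS (le_trans _ IH)// [e (n + k)%N]eS.
  by have := ustep (n + k)%N x; rewrite ler_norml => /andP[_]; lra.
have lower n (k : nat) x : u n x - e n <= u (n + k)%N x - e (n + k)%N.
  elim: k => [|k IH]; first by rewrite addn0.
  rewrite addnS (le_trans IH)// [e (n + k)%N]eS.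
  by have := ustep (n + k)%N x; rewrite ler_norml => /andP[+ _]; lra.
have low_up i j x : u i x - e i <= u j x + e j.
  rewrite (le_trans (lower i j x))// (le_trans _ (upper j i x))// [(j + i)%N]addnC.
  by have := e0 (i + j)%N; lra.
(* [u n x + e n] decreases and [u n x - e n] increases to the limit. *)
pose w x := inf (range (fun n => u n x + e n)).
have wu n x : `|w x - u n x| <= e n.
  have lb : lbound (range (fun n => u n x + e n)) (u n x - e n).
    by move=> _ [k _ <-]; exact: low_up.
  rewrite ler_distl; apply/andP; split.
    by apply: lb_le_inf => //; exists (u n x + e n); exists n.
  have hlb : has_lbound (range (fun n => u n x + e n)) by exists (u n x - e n).
  by have := ge_inf hlb; apply; exists n.
have small (z K : R) : (forall n, z <= K * e n) -> z <= 0.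
  move=> H; apply: (@le0_of_geometric (K * (2 * delta))) => n.
  by rewrite -mulrA; exact: H.
have wL x : w (x + L) = w x.
  rewrite /w (_ : (fun n => u n (x + L) + e n) = (fun n => u n x + e n))//.
  by apply/funext => n; have [_ -> _] := Au n.
have wd x : `|w x| <= delta.
  rewrite -subr_le0; apply: (small _ 1) => n; rewrite mul1r lerBlDr.
  rewrite -[w x](subrK (u n x)) (le_trans (ler_normD _ _))// lerD//.
  by have [_ _] := Au n.
have mean_le f : admits f -> `|mean f| <= 2 * eta.
  move=> [cf _ fd]; rewrite normrM normfV (gtr0_norm L0) ler_pdivrMr//.
  rewrite -[L in leRHS]subr0; apply: norm_int_le => // [|x _].
    by apply: bmfD; [exact: bmfc|apply: bmfX; exact: bmfc].
  rewrite (le_trans (ler_normD _ _))// mulr_natl mulr2n lerD//.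
  rewrite normrX (le_trans _ delta2)// lerXn2r ?nnegrE ?(ltW delta0)//.
pose G n x := mean (u n) - 2 * lambda * u n.+1 x - (h x + u n x ^+ 2).
have pu n a c : a <= c -> prim a c (u n.+1) (G n).
  move=> ac; have [[cT _ _] _ dT] := HT _ (Au n); have [cu _ _] := Au n.
  apply: prim_is_derive => //; apply: continuous_subspaceT => z.
  apply: cvgB; last by apply: cvgD; [exact: ch|apply: cvgM; exact: cu].
  by apply: cvgB; [exact: cvg_cst|apply: cvgM; [exact: cvg_cst|exact: cT]].
(* [2 * eta] for the mean, [eta] each for [h] and the square, the rest for the damping. This common
   Lipschitz constant passes to the limit [w], which makes its integrals available before the
   equation is passed to the limit. *)
pose K := 4 * eta + 2 * lambda * delta.
have GK n x : `|G n x| <= K.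
  have [_ _ ud1] := Au n.+1; have [_ _ ud] := Au n.
  have u2 : `|u n x ^+ 2| <= eta.
    by rewrite normrX (le_trans _ delta2)// lerXn2r ?nnegrE ?(ltW delta0)//.
  have ul : `|2 * lambda * u n.+1 x| <= 2 * lambda * delta.
    rewrite normrM (gtr0_norm (_ : 0 < 2 * lambda)) ?mulr_gt0//.
    by rewrite ler_wpM2l// ltW// mulr_gt0.
  have := mean_le _ (Au n); move: (heta x) u2 ul.
  rewrite /G /K !ler_norml => /andP[? ?] /andP[? ?] /andP[? ?] /andP[? ?].
  by apply/andP; split; lra.
have wlip x y : x <= y -> `|w y - w x| <= K * (y - x).
  move=> xy; rewrite -subr_le0; apply: (small _ 2) => n; rewrite lerBlDr.
  have -> : w y - w x = (w y - u n.+1 y) - (w x - u n.+1 x) + (u n.+1 y - u n.+1 x) by ring.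
  rewrite (le_trans (ler_normD _ _))// lerD//.
    rewrite (le_trans (ler_normB _ _))// mulr_natl mulr2n.
    by rewrite lerD// (le_trans (wu _ _)).
  rewrite ((pu n x y xy).2 x y)//; apply: norm_int_le => //.
  exact: (pu n x y xy).1.
have K0 : 0 <= K by apply: le_trans (GK 0%N 0).
have bw a c : bmf a c w.
  by apply: bmf_continuous; apply: (lipschitz_continuous K0) => x y _ xy _; exact: wlip.
have bu n a c : bmf a c (u n) by apply: bmfc; have [] := Au n.
have bh a c : bmf a c h by exact: bmfc.
have sq n x : `|w x ^+ 2 - u n x ^+ 2| <= 2 * delta * e n.
  have -> : w x ^+ 2 - u n x ^+ 2 = (w x + u n x) * (w x - u n x) by ring.
  rewrite normrM ler_pM// (le_trans (ler_normD _ _))// mulr_natl mulr2n lerD//.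
  by have [_ _] := Au n.
have meanw n : `|mean w - mean (u n)| <= 2 * delta * e n.
  rewrite /mean -mulrBl normrM normfV (gtr0_norm L0) ler_pdivrMr//.
  rewrite -intB; [|by apply: bmfD => //; exact: bmfX|by apply: bmfD => //; exact: bmfX].
  rewrite -[L in leRHS]subr0; apply: norm_int_le => // [|x _].
    by apply: bmfB; apply: bmfD => //; exact: bmfX.
  by rewrite opprD addrACA subrr add0r.
exists w, (mean w); split=> //.
- apply/eqP; rewrite -normr_le0; apply: (small _ L) => n.
  have [_ u0 _] := HT _ (Au n).
  have -> : sint 0 L w = sint 0 L (fun x => w x - u n.+1 x).
    by rewrite intB// u0 subr0.
  rewrite mulrC -[L in leRHS]subr0; apply: norm_int_le => // [|x _].
    exact: bmfB.
  exact: le_trans (wu _ _) (eSle n).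
- move=> a c ac.
  pose H t := mean w - h t - 2 * lambda * w t - w t ^+ 2.
  have bH a' c' : bmf a' c' H.
    by have := bw a' c'; have := bh a' c'; rewrite /H => *; bm.
  split=> // x y _ xy _.
  apply/eqP; rewrite -subr_eq0 -normr_le0.
  (* The 2 stems from the end points; in the integrand, the mean and the square contribute
     [2 * delta] each and the damping [2 * lambda]. *)
  apply: (small _ (2 + (4 * delta + 2 * lambda) * (y - x))) => n.
  have -> : w y - w x - sint x y H =
     (w y - u n.+1 y) - (w x - u n.+1 x) - sint x y (fun t => H t - G n t).
    rewrite (intB (bH x y) (pu n x y xy).1).
    by rewrite -((pu n x y xy).2 x y)//; ring.
  rewrite mulrDl (le_trans (ler_normB _ _))// lerD//.
    rewrite (le_trans (ler_normB _ _))// mulr_natl mulr2n.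
    by rewrite lerD// (le_trans (wu _ _)).
  rewrite mulrAC; apply: norm_int_le => // [|t _].
    by apply: bmfB => //; exact: (pu n x y xy).1.
  have -> : H t - G n t = (mean w - mean (u n)) - 2 * lambda * (w t - u n.+1 t)
      - (w t ^+ 2 - u n t ^+ 2) by rewrite /H /G; ring.
  have wl : `|2 * lambda * (w t - u n.+1 t)| <= 2 * lambda * e n.
    rewrite normrM (gtr0_norm (_ : 0 < 2 * lambda)) ?mulr_gt0//.
    rewrite ler_wpM2l//; first by rewrite ltW// mulr_gt0.
    exact: le_trans (wu _ _) (eSle n).
  move: (meanw n) wl (sq n t).
  rewrite !ler_norml => /andP[? ?] /andP[? ?] /andP[? ?].
  by apply/andP; split; lra.
Qed.

End FixedPoint.

End Existence.

(** * Oscillating perturbations of the constant *)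

Section Oscillation.
Context {R : realType}.
Implicit Types (f h w : R -> R).

Section TrigIntegrals.
Context {L omega : R}.
Hypotheses (L0 : 0 < L) (o0 : 0 < omega).
Hypotheses (sL : sin (omega * L) = 0) (cL : cos (omega * L) = 1).
Let c x := cos (omega * x).
Let s x := sin (omega * x).
Let L0' : 0 <= L. Proof. exact: ltW. Qed.

Lemma der_cos_scaled (x : R) : is_derive x 1 c (- omega * s x).
Proof.
apply: is_derive_eq (@der_comp _ cos (fun t => omega * t) x _ _ (is_derive_cos _)
  (derZ omega (der_id x))) _.
by rewrite /s; ring.
Qed.

Lemma der_sin_scaled (x : R) : is_derive x 1 s (omega * c x).
Proof.
apply: is_derive_eq (@der_comp _ sin (fun t => omega * t) x _ _ (is_derive_sin _)
  (derZ omega (der_id x))) _.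
by rewrite /c; ring.
Qed.

Lemma continuous_cos_scaled : continuous c.
Proof. by move=> x; exact: is_derive_continuous (der_cos_scaled x). Qed.

Lemma continuous_sin_scaled : continuous s.
Proof. by move=> x; exact: is_derive_continuous (der_sin_scaled x). Qed.

Lemma prim_cos_scaled : prim 0 L c (fun x => - omega * s x).
Proof.
apply: prim_is_derive => [x _|]; first exact: der_cos_scaled.
apply: continuous_subspaceT => x; apply: cvgM; first exact: cvg_cst.
exact: continuous_sin_scaled.
Qed.

Lemma prim_sin_scaled : prim 0 L s (fun x => omega * c x).
Proof.
apply: prim_is_derive => [x _|]; first exact: der_sin_scaled.
apply: continuous_subspaceT => x; apply: cvgM; first exact: cvg_cst.
exact: continuous_cos_scaled.
Qed.

Let bc : bmf 0 L c. Proof. exact: prim_bmf prim_cos_scaled. Qed.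
Let bs : bmf 0 L s. Proof. exact: prim_bmf prim_sin_scaled. Qed.
Let c0 : c 0 = 1. Proof. by rewrite /c mulr0 cos0. Qed.
Let s0 : s 0 = 0. Proof. by rewrite /s mulr0 sin0. Qed.
Let sL' : s L = 0. Proof. exact: sL. Qed.
Let cL' : c L = 1. Proof. exact: cL. Qed.

Lemma int_cos_scaled : sint 0 L c = 0.
Proof.
have := primE L0' prim_sin_scaled; rewrite sL' s0 subrr intZ//.
by move=> /eqP; rewrite mulf_eq0 gt_eqF//= => /eqP.
Qed.

Lemma int_cos2_scaled : sint 0 L (fun x => c x ^+ 2) = L / 2.
Proof.
have := primE L0' (primM prim_sin_scaled prim_cos_scaled).
rewrite sL' s0 !mul0r subrr.
rewrite (@eq_int _ _ _ _ (fun x => (2 * omega) * c x ^+ 2 - omega)); last first.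
  move=> x _; have : s x ^+ 2 = 1 - c x ^+ 2 by exact: sin2cos2.
  move=> E; transitivity (omega * c x ^+ 2 - omega * s x ^+ 2); first by ring.
  by rewrite E; ring.
rewrite intB; [|bm|bm]; rewrite intZ; last bm.
rewrite int_cst// subr0 => E.
have : omega * (2 * sint 0 L (fun x => c x ^+ 2) - L) = 0 by lra.
by move=> /eqP; rewrite mulf_eq0 gt_eqF//= => /eqP; lra.
Qed.

Lemma int_trig2_scaled (a b : R) :
  sint 0 L (fun x => (a * s x + b * c x) ^+ 2) = (a ^+ 2 + b ^+ 2) * (L / 2).
Proof.
have E2 : sint 0 L (fun x => s x * c x) = 0.
  have := primE L0' (primM prim_sin_scaled prim_sin_scaled).
  rewrite sL' s0 !mul0r subrr.
  rewrite (@eq_int _ _ _ _ (fun x => (2 * omega) * (s x * c x))); last first.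
    by move=> x _; ring.
  rewrite intZ; last bm.
  by move=> /eqP; rewrite mulf_eq0 gt_eqF ?mulr_gt0//= => /eqP.
rewrite (@eq_int _ _ _ _ (fun x => a ^+ 2 + (b ^+ 2 - a ^+ 2) * c x ^+ 2
   + (2 * a * b) * (s x * c x))); last first.
  move=> x _; have E : s x ^+ 2 = 1 - c x ^+ 2 by exact: sin2cos2.
  rewrite sqrrD exprMn E; ring.
rewrite intD; [|bm|bm]; rewrite intD; [|bm|bm]; rewrite int_cst//.
rewrite !intZ; [|bm|bm].
by rewrite E2 int_cos2_scaled; field.
Qed.

Section Pairing.
Context {w w1 : R -> R}.
Hypotheses (pw : prim 0 L w w1) (wL : w L = w 0).
Let bw : bmf 0 L w. Proof. exact: prim_bmf pw. Qed.
Let bw1 : bmf 0 L w1. Proof. exact: pw.1. Qed.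

Lemma int_deriv_cos : sint 0 L (fun x => w1 x * c x) = omega * sint 0 L (fun x => w x * s x).
Proof.
have := primE L0' (primM pw prim_cos_scaled).
rewrite cL' wL c0 subrr.
rewrite (@eq_int _ _ _ _ (fun x => w1 x * c x - omega * (w x * s x))); last first.
  by move=> x _; ring.
rewrite intB; [|bm|bm]; rewrite intZ; last bm.
by move=> /eqP; rewrite subr_eq0 => /eqP.
Qed.

Lemma int_deriv_sin : sint 0 L (fun x => w1 x * s x) = - (omega * sint 0 L (fun x => w x * c x)).
Proof.
have := primE L0' (primM pw prim_sin_scaled).
rewrite sL' s0 !mulr0 subrr.
rewrite (@eq_int _ _ _ _ (fun x => w1 x * s x + omega * (w x * c x))); last first.
  by move=> x _; ring.
rewrite intD; [|bm|bm]; rewrite intZ; last bm.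
by move=> /eqP; rewrite addr_eq0 => /eqP.
Qed.

End Pairing.

(** * Perturbations with a given second-order expansion in [eps] *)

Section Perturbation.
Context {A B T eps : R} {h : R -> R}.
Hypotheses (A0 : 0 < A) (B0 : 0 < B) (T0 : 0 < T) (eps0 : 0 < eps) (eps1 : eps <= 1).
Hypothesis bh : bmf 0 L h.
Hypothesis hE : forall x,
  `|h x - (A * eps * c x - B * eps ^+ 2 * c x ^+ 2)| <= T * eps ^+ 2 * c x ^+ 2.

Let c1 x : `|c x| <= 1. Proof. exact: cos_max. Qed.
Let s1 x : `|s x| <= 1. Proof. exact: sin_max. Qed.
Let c21 x : 0 <= c x ^+ 2 <= 1.
Proof. by rewrite sqr_ge0 -(real_normK (num_real _)) exprn_ile1. Qed.

Lemma pert_first_order x : `|h x - A * eps * c x| <= (B + T) * eps ^+ 2.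
Proof.
have /andP[c20 c2le] := c21 x.
have Be : 0 <= B * eps ^+ 2 by rewrite ltW// mulr_gt0// exprn_gt0.
have Te : 0 <= T * eps ^+ 2 by rewrite ltW// mulr_gt0// exprn_gt0.
have -> : h x - A * eps * c x = (h x - (A * eps * c x - B * eps ^+ 2 * c x ^+ 2))
   + - (B * eps ^+ 2 * c x ^+ 2) by ring.
rewrite (le_trans (ler_normD _ _))// mulrDl addrC lerD//.
  by rewrite normrN ger0_norm ?ler_piMr// mulr_ge0.
by rewrite (le_trans (hE x))// ler_piMr.
Qed.

Lemma pert_sup x : `|h x| <= (A + B + T) * eps.
Proof.
rewrite -[h x](subrK (A * eps * c x)) (le_trans (ler_normD _ _))//.
have := pert_first_order x; have BT : 0 < B + T by rewrite addr_gt0.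
have e2 : eps ^+ 2 <= eps by rewrite expr2 ler_piMr// ltW.
have : (B + T) * eps ^+ 2 <= (B + T) * eps by rewrite ler_wpM2l// ltW.
have : `|A * eps * c x| <= A * eps.
  rewrite normrM (gtr0_norm (_ : 0 < A * eps)) ?mulr_gt0// ler_piMr// ltW//.
  exact: mulr_gt0.
by lra.
Qed.

(** The cosine has mean zero and its square mean 1/2; the error allowed by [hE] carries the squared
    cosine, so it only shifts [B] by [T]. *)
Lemma pert_mean : - ((B + T) * eps ^+ 2 * (L / 2)) <= sint 0 L h
  <= - ((B - T) * eps ^+ 2 * (L / 2)).
Proof.
have E (k : R) : sint 0 L (fun x => (A * eps) * c x + k * c x ^+ 2) = k * (L / 2).
  rewrite intD; [|bm|bm]; rewrite !intZ; [|bm|bm].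
  by rewrite int_cos_scaled int_cos2_scaled; ring.
rewrite -!mulNr -!E; apply/andP; split; apply: le_int; try bm.
  by move=> x _; have := hE x; rewrite ler_norml => /andP[+ _]; lra.
by move=> x _; have := hE x; rewrite ler_norml => /andP[_]; lra.
Qed.

Section Bounds.
Context {lambda C : R} {w : R -> R}.
Hypotheses (l0 : 0 < lambda) (rw : riccati L lambda h C w).
Let w1 x := C - h x - 2 * lambda * w x - w x ^+ 2.
Let pw : prim 0 L w w1. Proof. by have [_ _ /(_ _ _ L0')] := rw. Qed.
Let wL : w L = w 0. Proof. by have [+ _ _] := rw => /(_ 0); rewrite add0r. Qed.
Let bw : bmf 0 L w. Proof. exact: prim_bmf pw. Qed.
Let bw1 : bmf 0 L w1. Proof. exact: pw.1. Qed.
Let eta := (A + B + T) * eps.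
Let eta0 : 0 < eta. Proof. by rewrite mulr_gt0 ?addr_gt0. Qed.
Let wM x : 0 <= x <= L -> `|w x| <= L * eta.
Proof. by apply: (riccati_sup L0 bh rw) => y _; exact: pert_sup. Qed.

Let W := sint 0 L (fun x => w x ^+ 2).
Let W0 : 0 <= W. Proof. by apply: int_ge0 => x _; exact: sqr_ge0. Qed.

(* Cauchy-Schwarz with the test function [omega sin + 2 lambda cos], in the form
   [\int (w + theta X)^2 >= 0]. *)
Lemma pert_lower (theta : R) : 0 <= theta ->
  2 * theta * (A * (L / 2) * eps
     - (L * (B + T) + L ^+ 3 * (A + B + T) ^+ 2) * eps ^+ 2)
  - theta ^+ 2 * ((omega ^+ 2 + 4 * lambda ^+ 2) * (L / 2)) <= W.
Proof.
move=> th0; pose X x := omega * s x + (2 * lambda) * c x.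
have bX : bmf 0 L X by rewrite /X; bm.
have X2 : sint 0 L (fun x => X x ^+ 2) = (omega ^+ 2 + 4 * lambda ^+ 2) * (L / 2).
  by rewrite int_trig2_scaled; ring.
(* Integration by parts turns [omega * w * sin] into [w' * cos], so pairing [w] with [X] amounts to
   testing the equation with the cosine, which removes [C]. *)
have wX : sint 0 L (fun x => w x * X x) =
    - sint 0 L (fun x => h x * c x) - sint 0 L (fun x => w x ^+ 2 * c x).
  rewrite (@eq_int _ _ _ _ (fun x => omega * (w x * s x) + (2 * lambda) * (w x * c x))).
    rewrite intD; [|bm|bm]; rewrite !intZ; [|bm|bm].
    rewrite -(int_deriv_cos pw wL).
    rewrite (@eq_int _ _ _ (fun x => w1 x * c x) (fun x => C * c x - h x * c x
      - (2 * lambda) * (w x * c x) - w x ^+ 2 * c x)).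
      rewrite intB; [|bm|bm]; rewrite intB; [|bm|bm]; rewrite intB; [|bm|bm].
      by rewrite !intZ; [|bm|bm]; rewrite int_cos_scaled; ring.
    by move=> x _; rewrite /w1; ring.
  by move=> x _; rewrite /X; ring.
have hc : A * eps * (L / 2) - (B + T) * eps ^+ 2 * L <= sint 0 L (fun x => h x * c x).
  rewrite -[L in X in _ - X]subr0 -int_cst// -int_cos2_scaled -intZ; last bm.
  rewrite -intB; [|bm|bm]; apply: le_int; [bm|bm|move=> x _].
  have : `|(h x - A * eps * c x) * c x| <= (B + T) * eps ^+ 2.
    by rewrite normrM (le_trans _ (pert_first_order x))// ler_piMr.
  by rewrite ler_norml => /andP[+ _]; lra.
have wc : - (L ^+ 3 * (A + B + T) ^+ 2 * eps ^+ 2) <= sint 0 L (fun x => w x ^+ 2 * c x).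
  have -> : L ^+ 3 * (A + B + T) ^+ 2 * eps ^+ 2 = (L * eta) ^+ 2 * (L - 0).
    by rewrite /eta; ring.
  have : `|sint 0 L (fun x => w x ^+ 2 * c x)| <= (L * eta) ^+ 2 * (L - 0).
    apply: norm_int_le => //; first bm.
    move=> x xL; rewrite normrM normrX -[leRHS]mulr1 ler_pM ?exprn_ge0//.
    by rewrite lerXn2r ?nnegrE ?wM// mulr_ge0// ltW.
  by rewrite ler_norml => /andP[].
have : 0 <= sint 0 L (fun x => (w x + theta * X x) ^+ 2) by apply: int_ge0 => x _; exact: sqr_ge0.
rewrite (@eq_int _ _ _ _ (fun x => w x ^+ 2 + (2 * theta) * (w x * X x)
  + theta ^+ 2 * X x ^+ 2)); last by move=> x _; ring.
rewrite intD; [|bm|bm]; rewrite intD; [|bm|bm]; rewrite !intZ; [|bm|bm].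
rewrite X2 wX -/W.
move: hc wc; set I := sint _ _ _; set J := sint _ _ _ => hc wc.
have := ler_wpM2l th0 (lerD hc wc).
by lra.
Qed.

(** Integrating [w * cos] by parts gains [1 / omega], as [w'] is controlled by [h], while the rest
    of [h] is of order [eps ^+ 2]. The condition [L * eta <= lambda] preserves half of the damping
    coefficient [2 * lambda]. *)
Lemma pert_upper : L * eta <= lambda ->
  lambda * W <= (A * (A + B + T) * L / omega) * eps ^+ 2
    + ((B + T) * (A + B + T) * L ^+ 2) * eps ^+ 3.
Proof.
move=> etal; have := riccati_upper_pairing L0 bh rw wM; rewrite -/W => H.
have {}H : lambda * W <= - sint 0 L (fun x => h x * w x).
  apply: le_trans H; rewrite ler_wpM2r//; lra.
apply: (le_trans H).
rewrite (@eq_int _ _ _ _ (fun x => (A * eps) * (w x * c x)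
  + (h x - A * eps * c x) * w x)); last by move=> x _; ring.
rewrite intD; [|bm|bm]; rewrite intZ; last bm.
have wc : - sint 0 L (fun x => w x * c x) <= L * eta / omega.
  rewrite ler_pdivlMr// mulNr [X in - X]mulrC -(int_deriv_sin pw).
  rewrite (le_trans (ler_norm _))// (le_trans (norm_int _))//; first bm.
  have w1L : sint 0 L (fun x => w1 x ^+ 2) <= L * eta ^+ 2.
    apply: (le_trans (riccati_energy L0 bh rw)).
    have -> : L * eta ^+ 2 = eta ^+ 2 * (L - 0) by ring.
    rewrite -int_cst//; apply: le_int; [bm|bm|move=> x xL].
    rewrite -(real_normK (num_real (h x))) lerXn2r ?nnegrE ?pert_sup//.
    exact: ltW.
  apply: le_trans (int_norm_le L0 (ltW eta0) bw1 w1L).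
  apply: le_int => [||x _]; [by apply: bmf_norm; bm|exact: bmf_norm|].
  by rewrite normrM ler_piMr.
have hw : - sint 0 L (fun x => (h x - A * eps * c x) * w x) <=
    (B + T) * eps ^+ 2 * (L * eta) * (L - 0).
  rewrite (le_trans (ler_norm _))// normrN; apply: norm_int_le => //; first bm.
  move=> x xL; rewrite normrM ler_pM//; [exact: pert_first_order|exact: wM].
have := ler_wpM2l (ltW (mulr_gt0 A0 eps0)) wc.
have -> : A * eps * (L * eta / omega) = (A * (A + B + T) * L / omega) * eps ^+ 2.
  by rewrite /eta; ring.
move: hw; have -> : (B + T) * eps ^+ 2 * (L * eta) * (L - 0) =
   ((B + T) * (A + B + T) * L ^+ 2) * eps ^+ 3 by rewrite /eta; ring.
by lra.
Qed.

End Bounds.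
End Perturbation.
End TrigIntegrals.
End Oscillation.

(** * Attainment of the minimal speed for small perturbations *)

Section Attained.
Context {R : realType}.
Implicit Types (h w : R -> R).

(** The contraction gives a solution for each [lambda], and [riccati_lipschitz] the uniqueness of
    the eigenvalue and the continuity of [C]. Since [C] stays within [m / 2], the minimum over
    [[s / 8, 4 * s]] is global. *)
Lemma cstar_attained {L m eta : R} {h} : 0 < L -> 0 < m -> 0 < eta ->
  8 * L ^+ 2 * eta <= 1 -> 4 * eta <= m ->
  continuous h -> (forall x, h (x + L) = h x) -> (forall x, `|h x| <= eta) ->
  exists lambda w C, [/\ 0 < lambda, riccati L lambda h C w &
    cstar L (fun x => m + h x) = (lambda ^+ 2 + m + C) / lambda].
Proof.
move=> L0 m0 eta0 L8 etam ch hL heta; have L0' := ltW L0.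
have bh a c : bmf a c h by apply: bmf_continuous; exact: continuous_subspaceT.
have heta' x : 0 <= x <= L -> `|h x| <= eta by [].
have [Cf HC] : exists Cf : R -> R, forall l, 0 < l -> exists w, riccati L l h (Cf l) w.
  suff H (l : R) : exists C, 0 < l -> exists w, riccati L l h C w.
    by have [Cf HCf] := choice H; exists Cf.
  have [l0|] := pselect (0 < l); last by exists 0.
  have [w [C rw]] := riccati_exists L0 l0 eta0 L8 ch hL heta.
  by exists C => _; exists w.
have pE l : 0 < l -> principal_eigenvalue L l (fun x => m + h x) = - (Cf l + l ^+ 2 + m).
  move=> l0; have [w rw] := HC l l0.
  apply: xget_unique => [|k sk]; first exact: solution_of_riccati rw.
  have bE : {ae (@lebesgue_measure R), forall x, m + h x = m + h x} by exact: aeW.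
  have [v rv] := riccati_of_solution (b0 := m) bh bE sk L0.
  have := riccati_lipschitz L0 eta0 L8 (bh _ _) heta' rw rv.
  by rewrite subrr normr0 mulr0 normr_le0 => /eqP; lra.
have Cbound l : 0 < l -> `|Cf l| <= m / 2.
  move=> l0; have [w rw] := HC l l0.
  have wM := riccati_sup L0 (bh _ _) rw heta'.
  have bw : bmf 0 L w by have [_ _ /(_ _ _ L0')] := rw; exact: prim_bmf.
  apply: (@le_trans _ _ (2 * eta)); last by lra.
  rewrite -(ler_pM2l L0) -{1}[L]gtr0_norm// -normrM (riccati_mean L0 (bh _ _) rw).
  rewrite -intD; [|by []|bm].
  have -> : L * (2 * eta) = 2 * eta * (L - 0) by ring.
  apply: norm_int_le => // [|x xL]; first by apply: bmfD => //; bm.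
  rewrite (le_trans (ler_normD _ _))// mulr_natl mulr2n lerD//.
  rewrite normrX (@le_trans _ _ ((L * eta) ^+ 2))//.
    by rewrite lerXn2r ?nnegrE ?wM// mulr_ge0// ltW.
  have -> : (L * eta) ^+ 2 = (8 * L ^+ 2 * eta) * (eta / 8) by field.
  by have := ler_wpM2r (ltW eta0) L8; lra.
pose s := Num.sqrt m.
have s0 : 0 < s by rewrite sqrtr_gt0.
have s2 : s ^+ 2 = m by rewrite sqr_sqrtr// ltW.
pose V l := (l ^+ 2 + m + Cf l) / l.
have speedsE l : 0 < l -> - principal_eigenvalue L l (fun x => m + h x) / l = V l.
  by move=> l0; rewrite pE// opprK /V; congr (_ / _); ring.
have ab : s / 8 <= 4 * s by lra.
have cC : {within `[s / 8, 4 * s], continuous Cf}.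
  apply: (@lipschitz_continuous _ _ _ (2 * L * eta)); first by rewrite !mulr_ge0// ltW.
  move=> x y sx xy _; have x0 : 0 < x by apply: lt_le_trans sx; rewrite divr_gt0.
  have [w rw] := HC x x0; have [v rv] := HC y (lt_le_trans x0 xy).
  have := riccati_lipschitz L0 eta0 L8 (bh _ _) heta' rv rw.
  by rewrite (ger0_norm (_ : 0 <= y - x))// subr_ge0.
have cV : {within `[s / 8, 4 * s], continuous V}.
  have cid : {within `[s / 8, 4 * s], continuous (fun x : R => x)}.
    by apply: continuous_subspaceT => x; exact: cvg_id.
  have cinv : {within `[s / 8, 4 * s], continuous (fun x : R => x^-1)}.
    apply: continuous_in_subspaceT => x /[!inE]/=; rewrite in_itv/= => /andP[sx _].
    by apply: inv_continuous; rewrite gt_eqF// (lt_le_trans _ sx)// divr_gt0.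
  move=> x; apply: cvgM; last exact: cinv.
  apply: cvgD; last exact: cC.
  by apply: cvgD; [apply: cvgM; exact: cid|exact: cvg_cst].
have [l] := EVT_min ab cV.
rewrite in_itv/= => /andP[sl ls] Vmin.
have l0 : 0 < l by apply: lt_le_trans sl; rewrite divr_gt0.
(* [V s] is at most [(2 * m + m / 2) / s]. Below [s / 8] the part [m + C >= m / 2] of the numerator
   already exceeds this level times [t], and above [4 * s] the part [t ^+ 2] does. *)
have Vs : V l <= 5 / 2 * s.
  apply: (le_trans (Vmin s _)); first by rewrite in_itv/=; lra.
  rewrite /V s2 ler_pdivrMr//.
  have := Cbound s s0; rewrite ler_norml => /andP[_].
  have -> : 5 / 2 * s * s = 5 / 2 * m by rewrite -s2; ring.
  by lra.
have Vlow t : 0 < t -> V l <= V t.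
  move=> t0; have := Cbound t t0; rewrite ler_norml => /andP[Ct _].
  have [ts|st] := ltP t (s / 8).
    apply: (le_trans Vs); rewrite /V ler_pdivlMr//.
    have : s * t <= s * (s / 8) by rewrite ler_pM2l// ltW.
    have -> : s * (s / 8) = m / 8 by rewrite -s2; field.
    by have := sqr_ge0 t; lra.
  have [ts4|st4] := leP t (4 * s); first by apply: Vmin; rewrite in_itv/= st.
  apply: (le_trans Vs); rewrite /V ler_pdivlMr//.
  have : t * (4 * s) <= t * t by rewrite ler_pM2l// ltW.
  have : 0 < s * t by rewrite mulr_gt0.
  by lra.
have [w rw] := HC l l0.
exists l, w, (Cf l); split=> //.
apply: cstar_unique; first by exists l => //; rewrite speedsE.
by move=> _ [t /= t0 <-]; rewrite speedsE//; exact: Vlow.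
Qed.

End Attained.

(** * The explicit oscillating family *)

Section Family.
Context {R : realType}.
Notation mu := (@lebesgue_measure R).

Lemma exists_small (s : seq (R * R)) :
  all (fun kb => (0 <= kb.1) && (0 < kb.2)) s ->
  exists2 e : R, 0 < e & all (fun kb => kb.1 * e <= kb.2) s.
Proof.
elim: s => [|[k b] s IH]/=; first by exists 1.
move=> /andP[/andP[k0 b0] s0]; have [e e0 He] := IH s0.
have k1 : 0 < k + 1 by rewrite ltr_wpDl.
set d := Num.min e (b / (k + 1)).
have d0 : 0 < d by rewrite lt_min e0 divr_gt0.
have [de dk] : d <= e /\ d <= b / (k + 1).
  by rewrite /d; split; rewrite ge_min lexx ?orbT.
exists d => //; apply/andP; split.
  rewrite ler_pdivlMr// in dk; apply: le_trans dk.
  by rewrite mulrC ler_pM2l// lerDl.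
apply/allP => kb kbs; have /andP[kb0 _] := allP s0 _ kbs.
by apply: le_trans (allP He _ kbs); exact: ler_wpM2l.
Qed.

Lemma sin_cos_multiple (n : nat) : sin ((2 * pi : R) * n%:R) = 0 /\ cos ((2 * pi : R) * n%:R) = 1.
Proof.
have -> : 2 * pi * n%:R = 0 + (pi *+ 2) *+ n :> R.
  by rewrite add0r -[RHS]mulr_natr -[pi *+ 2]mulr_natl.
by rewrite (periodicn (@sinD2pi R)) (periodicn (@cosD2pi R)) sin0 cos0.
Qed.

(* With this choice [(m + osc)^p = m^p (1 + eps cos (omega x))] exactly, so the
   constraint holds for every [eps] in [(0, 1)]. *)
Definition osc (m p eps omega x : R) := m * (1 + eps * cos (omega * x)) `^ p^-1 - m.

(** [e0] is uniform in [omega], so that the frequency can be fixed before the amplitude. The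
    quadratic coefficient is that of the power [1 / p], negative by concavity. *)
Lemma osc_taylor {p m T : R} : 1 < p -> 0 < m -> 0 < T ->
  exists2 e0 : R, 0 < e0 & forall eps omega x : R, 0 < eps -> eps <= e0 ->
    `|osc m p eps omega x - (m / p * eps * cos (omega * x)
       - m * (p - 1) / (2 * p ^+ 2) * eps ^+ 2 * cos (omega * x) ^+ 2)|
    <= T * eps ^+ 2 * cos (omega * x) ^+ 2.
Proof.
move=> p1 m0 T0; have p0 : 0 < p by exact: lt_trans p1.
have [e0 e00 H] := @powR_taylor2 R p^-1 (T / m) (divr_gt0 T0 m0).
exists e0 => // eps omega x eps0 epse; set y := cos _.
have ey : `|eps * y| <= e0.
  rewrite normrM (gtr0_norm eps0); apply: le_trans epse.
  by rewrite ler_piMr ?cos_max// ltW.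
have := ler_wpM2l (ltW m0) (H _ ey).
rewrite -{1}(gtr0_norm m0) -normrM.
have -> : m * (T / m * (eps * y) ^+ 2) = T * eps ^+ 2 * y ^+ 2.
  by field; rewrite gt_eqF.
apply: le_trans; rewrite le_eqVlt; apply/orP; left; apply/eqP; congr (`|_|).
by rewrite /osc -/y; field; rewrite gt_eqF.
Qed.

Section Membership.
Context {L beta p eps omega : R}.
Hypotheses (L0 : 0 < L) (beta0 : 0 < beta) (p1 : 1 < p).
Hypotheses (eps0 : 0 < eps) (eps1 : eps < 1) (o0 : 0 < omega).
Hypotheses (sL : sin (omega * L) = 0) (cL : cos (omega * L) = 1).
Let m := beta `^ p^-1.
Let h := osc m p eps omega.
Let p0 : 0 < p. Proof. exact: lt_trans p1. Qed.
Let m0 : 0 < m. Proof. exact: powR_gt0. Qed.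

Let pos x : 0 < 1 + eps * cos (omega * x).
Proof.
have : `|eps * cos (omega * x)| <= eps.
  by rewrite normrM (gtr0_norm eps0) ler_piMr ?cos_max// ltW.
by rewrite ler_norml => /andP[+ _]; have := eps1; lra.
Qed.

Lemma osc_continuous : continuous h.
Proof.
move=> x; apply: cvgB; last exact: cvg_cst.
apply: cvgM; first exact: cvg_cst.
pose g (t : R) := 1 + eps * cos (omega * t).
have cg : {for x, continuous g}.
  apply: cvgD; first exact: cvg_cst.
  by apply: cvgM; [exact: cvg_cst|exact: continuous_cos_scaled].
apply: (@continuous_comp _ _ _ g (fun z => z `^ p^-1)) => //.
exact: is_derive_continuous (is_derive1_powR _ (pos x)).
Qed.

Lemma osc_periodic x : h (x + L) = h x.
Proof. by rewrite /h /osc mulrDr cosD sL cL mulr0 mulr1 subr0. Qed.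

Lemma osc_admissible : admissible p L beta (fun x => m + h x).
Proof.
have cb : continuous (fun x => m + h x).
  by move=> x; apply: cvgD; [exact: cvg_cst|exact: osc_continuous].
have bE x : m + h x = m * (1 + eps * cos (omega * x)) `^ p^-1.
  by rewrite /h /osc addrC subrK.
split.
- exact: locally_integrable_continuous.
- by apply: aeW => x; rewrite osc_periodic.
- by apply: aeW => x; rewrite bE mulr_ge0 ?powR_ge0// ltW.
- have E x : ((m + h x) `^ p) = beta * (1 + eps * cos (omega * x)).
    rewrite bE powRM ?powR_ge0 ?(ltW m0)// powR_root// -powRrM mulVf ?gt_eqF//.
    by rewrite powRr1// ltW.
  under eq_integral do rewrite E.
  have bc := prim_bmf (@prim_cos_scaled R L omega).
  have bf : bmf 0 L (fun x => beta * (1 + eps * cos (omega * x))) by bm.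
  rewrite -[X in (_ * X)%E]fineK; last first.
    exact: (integrable_fin_num _ (bmf_integrable bf)).
  rewrite -EFinM; congr (_%:E).
  rewrite -[fine _]/(sint 0 L (fun x => beta * (1 + eps * cos (omega * x)))).
  rewrite intZ; last bm.
  rewrite intD; [|bm|bm]; rewrite intZ; last bm.
  rewrite int_cst ?(ltW L0)// int_cos_scaled//.
  by field; rewrite gt_eqF.
Qed.

End Membership.

End Family.

(** * Nearby coefficients with larger and with smaller speed *)

Section NotExtremal.
Context {R : realType}.
Context {L beta p : R}.
Hypotheses (L0 : 0 < L) (beta0 : 0 < beta) (p1 : 1 < p).
Let m := beta `^ p^-1.
Let s := Num.sqrt m.
Let A := m / p.
Let B := m * (p - 1) / (2 * p ^+ 2).
Let p0 : 0 < p. Proof. exact: lt_trans p1. Qed.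
Let p10 : 0 < p - 1. Proof. by rewrite subr_gt0. Qed.
Let m0 : 0 < m. Proof. exact: powR_gt0. Qed.
Let s0 : 0 < s. Proof. by rewrite sqrtr_gt0. Qed.
Let s2 : s ^+ 2 = m. Proof. by rewrite sqr_sqrtr// ltW. Qed.
Let A0 : 0 < A. Proof. exact: divr_gt0. Qed.
Let B0 : 0 < B. Proof. by rewrite divr_gt0 ?mulr_gt0 ?exprn_gt0. Qed.

Lemma Linf_dist_osc {T eps omega : R} : 
  (forall x, `|osc m p eps omega x| <= T) ->
  (Linf_dist (cst m) (fun x => m + osc m p eps omega x)%R <= T%:E)%E.
Proof.
move=> hT; apply/Linf_dist_le; apply: aeW => x.
by rewrite opprD addrA subrr add0r normrN.
Qed.

Lemma exists_larger_cstar {eta : R} : 0 < eta ->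
  (p - 1) * (4 * m + (2 * pi / L) ^+ 2) < 2 * m ->
  exists b, [/\ admissible p L beta b, (Linf_dist (cst m) b <= eta%:E)%E &
    cstar L (cst m) < cstar L b].
Proof.
move=> eta0 cond; pose omega := 2 * pi / L.
have o0 : 0 < omega by rewrite divr_gt0// mulr_gt0// pi_gt0.
have oL : omega * L = 2 * pi * 1%:R by rewrite mulr1 divfK// gt_eqF.
have [sL cL] : sin (omega * L) = 0 /\ cos (omega * L) = 1.
  by rewrite oL; exact: sin_cos_multiple.
have mp : 4 * m + omega ^+ 2 < 2 * m / (p - 1).
  by rewrite ltr_pdivlMr// mulrC.
(* [D] lies strictly between the two sides of the supercritical condition, and [sigma > s] solves
   [omega ^+ 2 + 4 * sigma ^+ 2 = D]. Up to [sigma] the contribution of [w] makes [C] positive;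
   beyond it [(lambda - s) ^+ 2] exceeds [rho ^+ 2]. *)
pose D := (4 * m + omega ^+ 2 + 2 * m / (p - 1)) / 2.
have [D1 D2] : 4 * m + omega ^+ 2 < D /\ D < 2 * m / (p - 1) by rewrite /D; split; lra.
have o20 : 0 < omega ^+ 2 by exact: exprn_gt0.
have D0 : 0 < D by have := m0; lra.
pose sigma := Num.sqrt ((D - omega ^+ 2) / 4).
have sigma2 : sigma ^+ 2 = (D - omega ^+ 2) / 4.
  by rewrite sqr_sqrtr//; have := m0; lra.
have ssigma : s < sigma by rewrite ltr_sqrt; have := m0; lra.
pose rho := sigma - s.
have rho0 : 0 < rho by rewrite subr_gt0.
(* The surplus at order [eps ^+ 2] of the mean of [w ^+ 2] over the loss in the mean of [h]. As
   Taylor tolerance it consumes half of itself; a further quarter goes to the terms of order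
   [eps ^+ 3]. *)
pose T := A ^+ 2 / (2 * D) - B / 2.
have T0 : 0 < T.
  have -> : T = A / (4 * p) * (2 * m / D - (p - 1)).
    by rewrite /T /A /B; field; rewrite !gt_eqF.
  rewrite mulr_gt0 ?divr_gt0 ?mulr_gt0// subr_gt0 ltr_pdivlMr// mulrC -ltr_pdivlMr//.
have [e0 e00 He0] := osc_taylor p1 m0 T0.
pose E := A + B + T.
have E0 : 0 < E by apply: addr_gt0 => //; exact: addr_gt0.
pose K2 := L * (B + T) + L ^+ 3 * E ^+ 2.
have K20 : 0 < K2.
  by apply: addr_gt0; apply: mulr_gt0; rewrite ?exprn_gt0//; exact: addr_gt0.
have BT0 : 0 < B + T by exact: addr_gt0.
have k3 : 0 < 8 * L ^+ 2 * E by rewrite pmulr_rgt0// mulr_gt0// exprn_gt0.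
have k4 : 0 < 4 * E by exact: mulr_gt0.
have k6 : 0 < 4 * A * K2 / D.
  by apply: divr_gt0 => //; apply: mulr_gt0 => //; exact: mulr_gt0.
have b6 : 0 < L * T / 2 by apply: divr_gt0 => //; exact: mulr_gt0.
have b7 : 0 < rho ^+ 2 by exact: exprn_gt0.
(* In order: Taylor range, [eps <= 1 / 2], two conditions of [cstar_attained], closeness to the
   constant, the error of order [eps ^+ 3], large [lambda]. *)
have [|eps eps0] := @exists_small R [:: (1, e0); (2, 1); (8 * L ^+ 2 * E, 1);
    (4 * E, m); (E, eta); (4 * A * K2 / D, L * T / 2); (B + T, rho ^+ 2)].
  by rewrite /= (ltW k3) (ltW k4) (ltW E0) (ltW k6) (ltW BT0) e00 eta0 b6 b7 m0 ler01 ltr01 ler0n.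
rewrite /= mul1r andbT => /and4P[ee0 e2 e8 /and4P[e4 eE eK eB]].
have eps1 : eps < 1 by lra.
pose h := osc m p eps omega.
have ch : continuous h by exact: osc_continuous.
have bh a c : bmf a c h by apply: bmf_continuous; exact: continuous_subspaceT.
have hE x := He0 eps omega x eps0 ee0.
have hsup x : `|h x| <= E * eps.
  exact: (pert_sup A0 B0 T0 eps0 (ltW eps1) hE).
exists (fun x => m + h x); split.
- exact: osc_admissible.
- by apply: Linf_dist_osc => x; rewrite (le_trans (hsup x)).
rewrite cstar_const// -/s.
have hper x : h (x + L) = h x by exact: osc_periodic.
have Ee0 : 0 < E * eps by exact: mulr_gt0.
have c8 : 8 * L ^+ 2 * (E * eps) <= 1 by rewrite mulrA.
have c4 : 4 * (E * eps) <= m by rewrite mulrA.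
have [lambda [w [C [l0 rw ->]]]] := cstar_attained L0 m0 Ee0 c8 c4 ch hper hsup.
rewrite ltr_pdivlMr//.
have meanh := pert_mean L0 o0 sL (bh _ _) hE.
suff : 0 < (lambda - s) ^+ 2 + C by rewrite sqrrB s2; lra.
have LC := riccati_mean L0 (bh _ _) rw.
have [ls|sl] := leP lambda sigma.
  suff C0 : 0 < C by apply: ltr_wpDl => //; exact: sqr_ge0.
  rewrite -(pmulr_rgt0 _ L0) LC.
  (* [eps * A / D] maximises the leading part of [pert_lower] in [theta], with [D] in place of
     [omega ^+ 2 + 4 * lambda ^+ 2]. *)
  have th0 : 0 <= eps * A / D by apply/ltW/divr_gt0 => //; exact: mulr_gt0.
  have := pert_lower L0 o0 sL cL A0 B0 T0 eps0 (ltW eps1) (bh _ _) hE rw _ th0.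
  rewrite -/E -/K2.
  have l2 : omega ^+ 2 + 4 * lambda ^+ 2 <= D.
    have : lambda ^+ 2 <= sigma ^+ 2 by rewrite lerXn2r ?nnegrE ?(ltW l0)// (le_trans (ltW l0)).
    by rewrite sigma2; lra.
  have H : (eps * A / D) ^+ 2 * ((omega ^+ 2 + 4 * lambda ^+ 2) * (L / 2)) <=
     (eps * A / D) ^+ 2 * (D * (L / 2)).
    by rewrite ler_wpM2l ?sqr_ge0// ler_wpM2r// divr_ge0// ltW.
  move=> Wl; have [h1 _] := andP meanh.
  have EH : (eps * A / D) ^+ 2 * (D * (L / 2)) = eps ^+ 2 * A ^+ 2 * L / (2 * D).
    by field; rewrite gt_eqF.
  rewrite EH in H.
  have E1 : 2 * (eps * A / D) * (A * (L / 2) * eps - K2 * eps ^+ 2) =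
     eps ^+ 2 * A ^+ 2 * L / D - eps ^+ 2 * (2 * A * K2 / D * eps).
    by field; rewrite gt_eqF.
  rewrite E1 in Wl.
  have E2 : eps ^+ 2 * A ^+ 2 * L / D - eps ^+ 2 * A ^+ 2 * L / (2 * D) =
     eps ^+ 2 * L * (T + B / 2).
    by rewrite /T; field; rewrite gt_eqF.
  have e2T : 0 < eps ^+ 2 * (L * T / 4).
    by rewrite mulr_gt0 ?exprn_gt0// divr_gt0// mulr_gt0.
  have E3 : eps ^+ 2 * (2 * A * K2 / D * eps) <= eps ^+ 2 * (L * T / 4).
    by rewrite ler_wpM2l ?sqr_ge0//; lra.
  have E4 : eps ^+ 2 * L * (T + B / 2) =
      4 * (eps ^+ 2 * (L * T / 4)) + eps ^+ 2 * L * (B / 2) by field.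
  have E5 : (B + T) * eps ^+ 2 * (L / 2) =
      2 * (eps ^+ 2 * (L * T / 4)) + eps ^+ 2 * L * (B / 2) by field.
  rewrite E4 in E2; rewrite E5 in h1.
  move: e2T E2 E3 h1 Wl H.
  move: (eps ^+ 2 * (L * T / 4)) (eps ^+ 2 * L * (B / 2)) => U V.
  move: (eps ^+ 2 * A ^+ 2 * L / D) (eps ^+ 2 * A ^+ 2 * L / (2 * D)) => P P2.
  move: (eps ^+ 2 * (2 * A * K2 / D * eps)) (_ * (_ * (L / 2))) => Q S.
  move: (sint 0 L h) (sint 0 L _) => I J.
  by lra.
(* For [lambda > sigma], dropping the square of [w] suffices: the mean of [h] is of order
   [eps ^+ 2], whence [C >= - rho ^+ 2]. *)
have : rho ^+ 2 < (lambda - s) ^+ 2.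
  by rewrite ltrXn2r ?nnegrE ?(ltW rho0)// /rho; lra.
have W0 : 0 <= sint 0 L (fun x => w x ^+ 2) by apply: int_ge0 => x _; exact: sqr_ge0.
have : - (rho ^+ 2) <= C; last by lra.
rewrite -(ler_pM2l L0) LC.
have [h1 _] := andP meanh.
have e2R : (B + T) * eps ^+ 2 * (L / 2) <= rho ^+ 2 * L.
  have -> : (B + T) * eps ^+ 2 * (L / 2) = ((B + T) * eps) * (eps / 2) * L by field.
  rewrite ler_wpM2r ?(ltW L0)//.
  apply: (@le_trans _ _ (rho ^+ 2 * (eps / 2))).
    by rewrite ler_wpM2r// divr_ge0// ltW.
  by rewrite ler_piMr ?sqr_ge0//; lra.
rewrite mulrN [L * _]mulrC; move: e2R h1 W0.
move: ((B + T) * eps ^+ 2 * (L / 2)) (rho ^+ 2 * L) => U V.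
move: (sint 0 L h) (sint 0 L _) => I J.
by lra.
Qed.

(** On either side of the threshold, concavity of the power [1 / p] lowers the mean of [h], and fast
    oscillation leaves [w] too small to compensate. *)
Lemma exists_smaller_cstar {eta : R} : 0 < eta ->
  exists b, [/\ admissible p L beta b, (Linf_dist (cst m) b <= eta%:E)%E &
    cstar L b < cstar L (cst m)].
Proof.
move=> eta0; pose T := B / 2; have T0 : 0 < T by exact: divr_gt0.
have [e0 e00 He0] := osc_taylor p1 m0 T0.
pose E := A + B + T.
have E0 : 0 < E by apply: addr_gt0 => //; exact: addr_gt0.
have BT0 : 0 < B + T by exact: addr_gt0.
(* With [omega >= n / L > q / L] the leading term of [pert_upper] is at most [s * B * L / 16]; the
   term of order [eps ^+ 3] gets the same share. After division by [s] they use up half of the gain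
   [B * L / 4] that [T = B / 2] leaves in the integral of [h]. *)
pose q := 16 * A * E * L / (B * s).
have q0 : 0 < q.
  apply: divr_gt0; last exact: mulr_gt0.
  by rewrite pmulr_lgt0// pmulr_lgt0// pmulr_rgt0.
have qn := archi_boundP (ltW q0); set n := Num.bound q in qn.
have n0 : 0 < n%:R :> R by exact: lt_trans qn.
pose omega := 2 * pi * n%:R / L.
have o0 : 0 < omega by rewrite divr_gt0// mulr_gt0// mulr_gt0// pi_gt0.
have [sL cL] : sin (omega * L) = 0 /\ cos (omega * L) = 1.
  have -> : omega * L = 2 * pi * n%:R by rewrite divfK// gt_eqF.
  exact: sin_cos_multiple.
have nomega : n%:R / L <= omega.
  rewrite ler_pM2r ?invr_gt0// ler_peMl ?(ltW n0)//.
  by have := @pi_ge2 R; lra.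
have om : A * E * L / omega <= s * (B * L / 16).
  rewrite ler_pdivrMr//.
  apply: (@le_trans _ _ (s * (B * L / 16) * (q / L))); last first.
    rewrite ler_wpM2l//.
      by apply/ltW/mulr_gt0 => //; apply: divr_gt0 => //; exact: mulr_gt0.
    by apply: le_trans nomega; rewrite ler_pM2r ?invr_gt0// ltW.
  by rewrite le_eqVlt; apply/orP; left; apply/eqP; rewrite /q; field; rewrite !gt_eqF.
pose K := (B + T) * E * L ^+ 2.
have K0 : 0 < K by apply: mulr_gt0; [exact: mulr_gt0|exact: exprn_gt0].
have LE : 0 < L * E by exact: mulr_gt0.
have sBL : 0 < s * (B * L / 16).
  by apply: mulr_gt0 => //; apply: divr_gt0 => //; exact: mulr_gt0.
have [|eps eps0] := @exists_small R [:: (1, e0); (2, 1); (E, eta); (L * E, s);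
    (K, s * (B * L / 16))].
  by rewrite /= (ltW E0) (ltW LE) (ltW K0) e00 eta0 sBL s0 ler01 ltr01 ler0n.
rewrite /= mul1r andbT => /and5P[ee0 e2 eE eL eK].
have eps1 : eps < 1 by lra.
pose h := osc m p eps omega.
have ch : continuous h by exact: osc_continuous.
have bh a c : bmf a c h by apply: bmf_continuous; exact: continuous_subspaceT.
have hE x := He0 eps omega x eps0 ee0.
have hsup x : `|h x| <= E * eps.
  exact: (pert_sup A0 B0 T0 eps0 (ltW eps1) hE).
exists (fun x => m + h x); split.
- exact: osc_admissible.
- by apply: Linf_dist_osc => x; rewrite (le_trans (hsup x)).
rewrite cstar_const// -/s.
have B8 : 0 < B * eps ^+ 2 / 8.
  by apply: divr_gt0 => //; apply: mulr_gt0 => //; exact: exprn_gt0.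
pose v := Num.max (- 2 * m) (- (B * eps ^+ 2 / 8)).
have v0 : v < 0.
  by rewrite gt_max mulNr !oppr_lt0 B8 andbT mulr_gt0.
have bE : {ae (@lebesgue_measure R), forall x, m + h x = m + h x} by exact: aeW.
have Cv w C : riccati L s h C w -> C <= v.
  move=> rw; rewrite le_max; apply/orP; right.
  have sl : L * ((A + B + T) * eps) <= s by rewrite mulrA.
  have := pert_upper L0 o0 sL A0 B0 T0 eps0 (ltW eps1) (bh _ _) hE rw sl.
  rewrite -/E -/K => Wu.
  have /andP[_ Iu] := pert_mean L0 o0 sL (bh _ _) hE.
  rewrite -(ler_pM2l L0) (riccati_mean L0 (bh _ _) rw).
  have Wu' : sint 0 L (fun x => w x ^+ 2) <= eps ^+ 2 * (B * L / 8).
    rewrite -(ler_pM2l s0); apply: (le_trans Wu).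
    have -> : s * (eps ^+ 2 * (B * L / 8)) =
       s * (B * L / 16) * eps ^+ 2 + s * (B * L / 16) * eps ^+ 2 by field.
    rewrite lerD ?ler_wpM2r ?sqr_ge0// exprS mulrA.
    by rewrite ler_wpM2r ?sqr_ge0.
  have EI : (B - T) * eps ^+ 2 * (L / 2) = 2 * (eps ^+ 2 * (B * L / 8)).
    by rewrite /T; field.
  have -> : L * - (B * eps ^+ 2 / 8) = - (eps ^+ 2 * (B * L / 8)) by field.
  rewrite EI in Iu; move: Iu Wu'.
  move: (eps ^+ 2 * _) (sint 0 L h) (sint 0 L _) => U I J.
  by lra.
have := cstar_le_of_riccati L0 m0 bh bE v Cv.
rewrite le_max lexx => /(_ isT); rewrite -/s => /le_lt_trans; apply.
by rewrite gtrDl pmulr_llt0 ?invr_gt0.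
Qed.

End NotExtremal.

Section Threshold.
Context {R : realType}.

(** The difference of the two sides is linear in [m], with zero at [threshold] and slope
    [2 * (3 - 2 * p) > 0]. *)
Lemma threshold_lt {L p m : R} : 0 < L -> p < 3 / 2 ->
  let threshold := 2 * (p - 1) * pi ^+ 2 / ((3 - 2 * p) * L ^+ 2) in
  ((m < threshold) = (2 * m < (p - 1) * (4 * m + (2 * pi / L) ^+ 2))) *
  ((threshold < m) = ((p - 1) * (4 * m + (2 * pi / L) ^+ 2) < 2 * m)).
Proof.
move=> L0 p32 threshold.
have d0 : 0 < 3 - 2 * p by lra.
have E : 2 * m - (p - 1) * (4 * m + (2 * pi / L) ^+ 2) =
    2 * (3 - 2 * p) * (m - threshold).
  by rewrite /threshold; field; rewrite !gt_eqF.
have d20 : 0 < 2 * (3 - 2 * p) by exact: mulr_gt0.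
split.
  by rewrite -[RHS]subr_lt0 E pmulr_rlt0// subr_lt0.
by rewrite -[RHS]subr_gt0 E pmulr_rgt0// subr_gt0.
Qed.

End Threshold.

Theorem corollary2p7 (R : realType) (L beta p : R)
    (hL : 0 < L) (hbeta : 0 < beta) (hp : 1 < p) :
  let A := admissible p L beta in
  let b0 : R -> R := cst (beta `^ p^-1) in
  let threshold : R := 2 * (p - 1) * pi ^+ 2 / ((3 - 2 * p) * L ^+ 2) in
  (3 / 2 <= p \/ (p < 3 / 2 /\ beta `^ p^-1 < threshold) ->
     local_maximizer A (cstar L) b0 /\
     exists2 eta : R, 0 < eta &
       forall b : R -> R, A b ->
         (0 < Linf_dist b0 b)%E -> (Linf_dist b0 b <= eta%:E)%E ->
         cstar L b < cstar L b0) /\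
  (p < 3 / 2 -> threshold < beta `^ p^-1 ->
     ~ local_maximizer A (cstar L) b0 /\ ~ local_minimizer A (cstar L) b0).
Proof.
move=> A b0 threshold; set m := beta `^ p^-1.
have m0 : 0 < m by exact: powR_gt0.
split=> [cond|p32]; last rewrite (threshold_lt hL p32).2 => cond.
  have {}cond : 2 * m < (p - 1) * (4 * m + (2 * pi / L) ^+ 2).
    case: cond => [p32|[p32]]; last by rewrite (threshold_lt hL p32).1.
    (* For [p >= 3 / 2] one has [2 * m <= (p - 1) * (4 * m)], and the term in [pi] makes the
       inequality strict. *)
    have : 0 < (p - 1) * (2 * pi / L) ^+ 2.
      by rewrite mulr_gt0 ?subr_gt0// exprn_gt0// divr_gt0// mulr_gt0// pi_gt0.
    have : 0 <= (p - 3 / 2) * m by rewrite mulr_ge0 ?subr_ge0// ltW.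
    by lra.
  have [eta eta0 H] := cstar_lt_const hL hbeta hp cond.
  split; last by exists eta => // b Ab bpos bm; exact: (H b Ab bm).2.
  split; first exact: admissible_const.
  by exists eta => // b Ab bm; exact: (H b Ab bm).1.
split=> -[_ [eta eta0 H]].
  have [b [Ab bm]] := exists_larger_cstar hL hbeta hp eta0 cond.
  by rewrite ltNge (H b Ab bm).
have [b [Ab bm]] := exists_smaller_cstar hL hbeta hp eta0.
by rewrite ltNge (H b Ab bm).
Qed.
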